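(* Let $\mu_0$ be a probability measure on a measurable space $\mathcal{X}$, let $m,n$ be integers with $1<m<n$, and let $\mu=\mu_0^n$ be the product measure on $\mathcal{X}^n$. Let $g:\mathcal{X}^m\to[-1,1]$ be measurable and symmetric (invariant under permutations of its arguments), and define $u:\mathcal{X}^n\to\mathbb{R}$ by $$u(\mathbf{x})=\binom{n}{m}^{-1}\sum_{1\le j_1<\dots<j_m\le n}g\left(x_{j_1},\dots,x_{j_m}\right).$$ Then for all $t>0$ $$\Pr\{|u-Eu|>t\}\le2\exp\left(\frac{-nt^2}{2m^2\,\sigma^2_{y\sim\mu_0}\left(E_{\mathbf{x}\sim\mu_0^{m-1}}[g(y,\mathbf{x})]\right)+\frac{m^2(m-1)^2}{n-m}+16m^2t/3}\right).$$
   Context: $\Pr$ and $E$ (without subscript) refer to the product measure $\mu=\mu_0^n$ on $\mathcal{X}^n$. $E_{\mathbf{x}\sim\mu_0^{m-1}}[g(y,\mathbf{x})]=\int_{\mathcal{X}^{m-1}}g(y,x_1,\dots,x_{m-1})\,d\mu_0^{m-1}(x_1,\dots,x_{m-1})$, and $\sigma^2_{y\sim\mu_0}(h(y))$ denotes the variance of $h(y)$ when $y$ is distributed according to $\mu_0$. *)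

(* Defs.v *)
From HB Require Import structures.
From mathcomp Require Import all_boot all_order all_algebra.
From mathcomp Require Import perm.
From mathcomp Require Import all_classical all_reals all_analysis.

Set Implicit Arguments.
Unset Strict Implicit.
Unset Printing Implicit Defensive.

Import Order.TTheory GRing.Theory Num.Theory.
Import numFieldNormedType.Exports.

Local Open Scope classical_set_scope.
Local Open Scope ring_scope.

Section cons_pair.
Context d (T : measurableType d) (n : nat).

Definition cons_pair (p : T * n.-tuple T) : n.+1.-tuple T :=
  [tuple of p.1 :: p.2].

Lemma measurable_cons_pair : measurable_fun [set: T * n.-tuple T] cons_pair.
Proof. exact: (measurable_cons measurable_fst measurable_snd). Qed.

HB.instance Definition _ := isMeasurableFun.Build _ _ _ _
  cons_pair measurable_cons_pair.

End cons_pair.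

(* mu0^0 is the point mass at the empty tuple, and mu0^(n+1) is the image of
   the binary product mu0 \x mu0^n under (x, s) |-> x :: s.  The lemma
   power_probabilityE below checks the value on measurable rectangles. *)
Fixpoint power_probability d (T : measurableType d) (R : realType)
    (mu0 : probability T R) (n : nat) : probability (n.-tuple T) R :=
  match n with
  | 0 => \d_([tuple] : 0.-tuple T)
  | k.+1 => distribution (mu0 \x power_probability mu0 k)%E
              (@cons_pair _ T k)
  end.

Lemma measurable_rectangle d (T : measurableType d) (n : nat)
    (A : 'I_n -> set T) : (forall i, measurable (A i)) ->
  measurable [set x : n.-tuple T | forall i, A i (tnth x i)].
Proof.
move=> mA.
rewrite (_ : [set _ | _] =
  \bigcap_(i in [set: 'I_n]) ((fun x : n.-tuple T => tnth x i) @^-1` A i));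
    last first.
  by apply/seteqP; split => x /= H i; [move=> _; exact: H | exact: (H i I)].
apply: fin_bigcap_measurable; first exact: finite_finset.
by move=> i _; rewrite -[X in measurable X]setTI; exact: measurable_tnth.
Qed.

Lemma power_probabilityE d (T : measurableType d) (R : realType)
    (mu0 : probability T R) (n : nat) (A : 'I_n -> set T) :
  (forall i, measurable (A i)) ->
  power_probability mu0 n [set x | forall i, A i (tnth x i)] =
  (\prod_(i < n) mu0 (A i))%E.
Proof.
elim: n A => [|n IHn] A mA.
  rewrite big_ord0 /= diracE mem_set//.
  by case.
rewrite big_ord_recl -IHn// /= /distribution /pushforward.
have mA' := measurable_rectangle (fun i => mA (lift ord0 i)).
rewrite -product_measure1E//.
congr (product_measure1 _ _ _); apply/seteqP; split => -[x s] /=.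
  move=> H; split => [|i]; first exact: (H ord0).
  by have := H (lift ord0 i); rewrite /cons_pair tnthS.
move=> [Hx Hs] i; case: (unliftP ord0 i) => [j ->|->].
  by rewrite /cons_pair tnthS; exact: Hs.
exact: Hx.
Qed.

Definition symmetric_fun (T U : Type) (m : nat) (g : m.-tuple T -> U) :=
  forall (s : 'S_m) (x : m.-tuple T), g [tuple tnth x (s i) | i < m] = g x.

(* The strictly sorted m-tuples of indices are exactly the
   j_1 < ... < j_m, and [tuple of map (tnth x) j] is (x_{j_1}, ..., x_{j_m}). *)
Definition U_statistic (T : Type) (R : realType) (m n : nat)
    (g : m.-tuple T -> R) (x : n.-tuple T) : R :=
  ('C(n, m)%:R)^-1 *
  \sum_(j : m.-tuple 'I_n | sorted ltn (map val j))
     g [tuple of map (tnth x) j].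

(* (y, x_1, ..., x_{m-1}); for 0 < m this is y :: x, the nth (with default
   value y, never reached) only avoiding a cast along m.-1.+1 = m. *)
Definition cons_pred (T : Type) (m : nat) (y : T) (x : m.-1.-tuple T) :
  m.-tuple T := [tuple nth y (y :: x) i | i < m].

Lemma cons_predE (T : Type) (m : nat) (y : T) (x : m.-1.-tuple T) :
  (0 < m)%N -> cons_pred y x = y :: x :> seq T.
Proof.
case: m x => // m x _.
apply: (@eq_from_nth _ y); first by rewrite !size_tuple.
move=> i; rewrite size_tuple => im.
by rewrite -(tnth_nth y (cons_pred y x) (Ordinal im)) tnth_mktuple.
Qed.

Definition partial_mean d (T : measurableType d) (R : realType)
    (mu0 : probability T R) (m : nat) (g : m.-tuple T -> R) (y : T) : R :=
  fine ('E_(power_probability mu0 m.-1)[fun x => g (cons_pred y x)])%E.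

(* Main.v *)
Require Import Defs.
From mathcomp Require Import all_boot all_order all_algebra.
From mathcomp Require Import all_classical all_reals all_analysis.
From mathcomp Require Import perm measurable_realfun ring lra.

(** The statistic u is the last value of the martingale that reveals the
    arguments from left to right, and its predictable quadratic variation V
    (qvar) has mean Var u.  Freedman's inequality (freedman) says that
    exp (l (u - E u) - phi(l) V) has mean at most 1, where phi(l) is about
    l^2 / 2.  Hoelder's inequality then removes V at the price of its
    exponential moments (cgf_le_qvar): log E exp (l (u - E u)) is at most a
    fraction e of the cumulant generating function of V at a point s with
    e * s close to l^2 / 2.

    What makes this useful is that V has a small quadratic variation of its
    own.  A function of several arguments whose dependence on one argument is
    hardly influenced by the others (interaction) has conditional standard
    deviations that vary little with the first argument, by Minkowski's
    inequality; hence the variance of its conditional variances is at most a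
    small multiple of their mean (var_var_slice).  Summed over the arguments
    this bounds the quadratic variation of V by A times conditional
    expectations of V, and a convexity argument replaces them by A * V under
    exponential moments (mean_expR_qvar2).  Feeding this back into
    cgf_le_qvar, with V in the place of u, bounds the cumulant generating
    function L of V by itself: L(s) <= s Var u + L(k s) / 2 with k <= 1, and
    L(k s) <= k L(s) by Jensen's inequality, so L(s) <= s Var u / (1 - k / 2)
    (cgf_qvar).  With the right fraction e this gives
    log E exp (l (u - E u)) <= l^2 Var u / (2 (1 - 8 q l / 3)), where
    q = m^2 / n for a U-statistic (cgf_bernstein), and the usual exponential
    Markov inequality for u and - u gives Bernstein's tail (bernstein).

    It remains to bound Var u.  For a symmetric function f, the variance
    splits into the variance of the first-order projection of f at the first
    argument, the variance of f averaged over that argument, and an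
    interaction term; the averaged function is again symmetric, with the same
    first-order projection, so that induction applies (var_symmetric).

    All of this is done by induction on the number of arguments, fixing or
    averaging the first one.  For U-statistics the induction is Pascal's
    recursion (slice_usum): fixing the first argument turns a sum over the
    m-subsets of n indices into a sum over m-subsets and one over
    (m - 1)-subsets of the other n - 1 indices. *)

Set Implicit Arguments.
Unset Strict Implicit.
Unset Printing Implicit Defensive.

Import Order.TTheory GRing.Theory Num.Theory.
Import numFieldNormedType.Exports.

Local Open Scope classical_set_scope.
Local Open Scope ring_scope.

(** * Bounded measurable functions and their means *)

Section bounded_measurable.
Context {R : realType}.

(** Every function below is bounded, and this class is closed under products,
    exponentials, sections and partial means: integrability is never an
    issue. *)
Definition bmeas d (T : measurableType d) (f : T -> R) :=
  measurable_fun [set: T] f /\ exists M : R, forall x, `|f x| <= M.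

Context d (T : measurableType d).
Implicit Types f g : T -> R.

Lemma bmeas_cst r : bmeas (fun _ : T => r).
Proof. by split; [exact: measurable_cst | exists `|r|]. Qed.

Lemma bmeasD f g : bmeas f -> bmeas g -> bmeas (fun x => f x + g x).
Proof.
move=> [mf [M fM]] [mg [N gN]]; split; first exact: measurable_funD.
by exists (M + N) => x; rewrite (le_trans (ler_normD _ _))// lerD.
Qed.

Lemma bmeasN f : bmeas f -> bmeas (fun x => - f x).
Proof.
move=> [mf [M fM]]; split; last by exists M => x; rewrite normrN.
exact: measurableT_comp.
Qed.

Lemma bmeasB f g : bmeas f -> bmeas g -> bmeas (fun x => f x - g x).
Proof. by move=> bf bg; exact: (bmeasD bf (bmeasN bg)). Qed.

Lemma bmeasM f g : bmeas f -> bmeas g -> bmeas (fun x => f x * g x).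
Proof.
move=> [mf [M fM]] [mg [N gN]]; split; first exact: measurable_funM.
by exists (M * N) => x; rewrite normrM ler_pM.
Qed.

Lemma bmeasX f n : bmeas f -> bmeas (fun x => f x ^+ n).
Proof.
move=> bf; elim: n => [|n IHn]; first exact: bmeas_cst.
rewrite (_ : (fun x => f x ^+ n.+1) = fun x => f x * f x ^+ n).
  exact: bmeasM.
by apply/funext => x; rewrite exprS.
Qed.

Lemma bmeas_expR f : bmeas f -> bmeas (fun x => expR (f x)).
Proof.
move=> [mf [M fM]]; split; first exact: measurableT_comp.
exists (expR M) => x; rewrite ger0_norm ?expR_ge0// ler_expR.
exact: le_trans (ler_norm _) (fM x).
Qed.

End bounded_measurable.

Lemma bmeas_comp (R : realType) d1 d2 (T1 : measurableType d1)
    (T2 : measurableType d2) (h : T1 -> T2) (f : T2 -> R) :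
  measurable_fun [set: T1] h -> bmeas f -> bmeas (fun x => f (h x)).
Proof.
move=> mh [mf [M fM]]; split; first exact: measurableT_comp.
by exists M => x; exact: fM.
Qed.

Section mean.
Context {R : realType} d (T : measurableType d) (P : probability T R).
Implicit Types f g : T -> R.

Definition mean f : R := \int[P]_x f x.

Definition var f : R := mean (fun x => (f x - mean f) ^+ 2).

Lemma bmeas_integrable f : bmeas f -> P.-integrable [set: T] (EFin \o f).
Proof.
move=> [mf [M fM]]; apply: measurable_bounded_integrable => //.
  by apply: (le_lt_trans (probability_le1 P measurableT)); exact: ltry.
exists M; split; first exact: num_real.
by move=> N MN x _; exact: le_trans (fM x) (ltW MN).
Qed.

Lemma EFin_mean f : bmeas f -> (mean f)%:E = (\int[P]_x (f x)%:E)%E.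
Proof.
move=> bf; rewrite /mean /Rintegral fineK//.
exact: (integrable_fin_num measurableT (bmeas_integrable bf)).
Qed.

Lemma mean_cst r : mean (fun=> r) = r.
Proof.
rewrite /mean Rintegral_cst// [X in fine X](_ : _ = 1%E) ?mulr1//.
exact: probability_setT.
Qed.

Lemma meanD f g : bmeas f -> bmeas g ->
  mean (fun x => f x + g x) = mean f + mean g.
Proof.
by move=> bf bg; rewrite /mean RintegralD//; exact: bmeas_integrable.
Qed.

Lemma meanB f g : bmeas f -> bmeas g ->
  mean (fun x => f x - g x) = mean f - mean g.
Proof.
by move=> bf bg; rewrite /mean RintegralB//; exact: bmeas_integrable.
Qed.

Lemma meanZ r f : bmeas f -> mean (fun x => r * f x) = r * mean f.
Proof. by move=> bf; rewrite /mean RintegralZl//; exact: bmeas_integrable. Qed.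

Lemma mean_ge0 f : (forall x, 0 <= f x) -> 0 <= mean f.
Proof. by move=> f0; exact: Rintegral_ge0. Qed.

Lemma le_mean f g : bmeas f -> bmeas g -> (forall x, f x <= g x) ->
  mean f <= mean g.
Proof.
by move=> bf bg fg; apply: le_Rintegral => //; exact: bmeas_integrable.
Qed.

Lemma eq_mean f g : f =1 g -> mean f = mean g.
Proof. by move=> /funext ->. Qed.

Lemma mean_le r f : bmeas f -> (forall x, f x <= r) -> mean f <= r.
Proof.
by move=> bf fr; rewrite -[leRHS]mean_cst le_mean//; exact: bmeas_cst.
Qed.

Lemma le_mean_cst r f : bmeas f -> (forall x, r <= f x) -> r <= mean f.
Proof.
by move=> bf fr; rewrite -[leLHS]mean_cst le_mean//; exact: bmeas_cst.
Qed.

Lemma ler_norm_mean r f : bmeas f -> (forall x, `|f x| <= r) ->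
  `|mean f| <= r.
Proof.
move=> bf fr; rewrite ler_norml mean_le ?le_mean_cst// => x;
  by have := fr x; rewrite ler_norml => /andP[].
Qed.

End mean.

Section mean_slices.
Context {R : realType} d1 d2 (T1 : measurableType d1) (T2 : measurableType d2).

Lemma bmeas_slicel (F : T1 * T2 -> R) x : bmeas F -> bmeas (fun y => F (x, y)).
Proof. by apply: bmeas_comp; exact: pair1_measurable. Qed.

Lemma bmeas_slicer (F : T1 * T2 -> R) y : bmeas F -> bmeas (fun x => F (x, y)).
Proof. by apply: bmeas_comp; exact: pair2_measurable. Qed.

Lemma bmeas_mean (P2 : probability T2 R) (F : T1 * T2 -> R) : bmeas F ->
  bmeas (fun x => mean P2 (fun y => F (x, y))).
Proof.
move=> bF; have [mF [M FM]] := bF; split; last first.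
  exists M => x; apply: ler_norm_mean => [|y]; last exact: FM.
  exact: bmeas_slicel.
rewrite (_ : (fun x => _) = fun x => mean P2 (fun y => F (x, y) + M) - M).
  apply: measurable_funB; last exact: measurable_cst.
  apply/measurable_EFinP.
  rewrite (_ : _ \o _ = fubini_F P2 (fun z => (F z + M)%:E)).
    apply: measurable_fun_fubini_tonelli_F => [|z].
      apply/measurable_EFinP.
      by apply: measurable_funD => //; exact: measurable_cst.
    rewrite lee_fin -lerBlDr sub0r.
    by have := FM z; rewrite ler_norml => /andP[].
  apply/funext => x /=; rewrite EFin_mean//.
  by apply: bmeasD; [exact: bmeas_slicel|exact: bmeas_cst].
apply/funext => x; rewrite meanD ?mean_cst ?addrK//; last exact: bmeas_cst.
exact: bmeas_slicel.
Qed.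

End mean_slices.

Section mean_prod.
Context {R : realType} d1 d2 (T1 : measurableType d1) (T2 : measurableType d2).
Context (P1 : probability T1 R) (P2 : probability T2 R).

Lemma mean_prod (F : T1 * T2 -> R) : bmeas F ->
  mean (P1 \x P2)%E F = mean P1 (fun x => mean P2 (fun y => F (x, y))).
Proof.
move=> bF; apply: EFin_inj; rewrite EFin_mean// EFin_mean; last first.
  exact: bmeas_mean.
rewrite -(integral12_prod_meas1 (bmeas_integrable (P1 \x P2)%E bF)).
by apply: eq_integral => x _; rewrite EFin_mean//; exact: bmeas_slicel.
Qed.

Lemma mean_swap (F : T1 * T2 -> R) : bmeas F ->
  mean P1 (fun x => mean P2 (fun y => F (x, y))) =
  mean P2 (fun y => mean P1 (fun x => F (x, y))).
Proof.
move=> bF; rewrite -mean_prod//; apply: EFin_inj; rewrite EFin_mean//.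
have bG : bmeas (fun z : T2 * T1 => F (z.2, z.1)).
  apply: (@bmeas_comp _ _ _ _ _ (fun z => (z.2, z.1))) bF.
  exact: measurable_swap.
rewrite EFin_mean; last exact: (bmeas_mean P1 bG).
rewrite -(integral21_prod_meas1 (bmeas_integrable (P1 \x P2)%E bF)).
by apply: eq_integral => y _; rewrite EFin_mean//; exact: bmeas_slicer.
Qed.

End mean_prod.

(** * Functions of several independent arguments, taken one at a time *)

Section tuples.
Context {R : realType} d (T : measurableType d) (mu0 : probability T R).

Local Notation "mu0 ^^ n" := (power_probability mu0 n) (at level 30).

Definition slice n (f : n.+1.-tuple T -> R) (y : T) : n.-tuple T -> R :=
  fun s => f (cons_tuple y s).

Lemma cons_tuple_eta n (x : n.+1.-tuple T) :
  cons_tuple (thead x) (behead_tuple x) = x.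
Proof. by case/tupleP: x => y s; apply: val_inj. Qed.

Lemma slice_eta n (f : n.+1.-tuple T -> R) x :
  f x = slice f (thead x) (behead_tuple x).
Proof. by rewrite /slice cons_tuple_eta. Qed.

Lemma behead_cons_tuple n y (s : n.-tuple T) :
  behead_tuple (cons_tuple y s) = s.
Proof. exact: val_inj. Qed.

Lemma bmeas_slice n (f : n.+1.-tuple T -> R) y : bmeas f -> bmeas (slice f y).
Proof.
apply: bmeas_comp.
by apply: (measurable_cons (f := fun=> y) (g := id)).
Qed.

Lemma bmeas_slice2 n (f : n.+1.-tuple T -> R) :
  bmeas f -> bmeas (fun z : T * n.-tuple T => slice f z.1 z.2).
Proof. by apply: bmeas_comp; exact: measurable_cons_pair. Qed.

Lemma bmeas_uncurry n (F : T * n.-tuple T -> R) :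
  bmeas F -> bmeas (fun x : n.+1.-tuple T => F (thead x, behead_tuple x)).
Proof.
apply: (@bmeas_comp _ _ _ _ _
  (fun x : n.+1.-tuple T => (thead x, behead_tuple x))).
apply/measurable_fun_pairP; split; first exact: (measurable_tnth ord0).
exact: measurable_behead.
Qed.

Lemma bmeas_mean_slice n (f : n.+1.-tuple T -> R) :
  bmeas f -> bmeas (fun y => mean (mu0 ^^ n) (slice f y)).
Proof. by move=> bf; exact: (bmeas_mean (mu0 ^^ n) (bmeas_slice2 bf)). Qed.

Lemma mean0E (f : 0.-tuple T -> R) : bmeas f -> mean (mu0 ^^ 0) f = f [tuple].
Proof.
move=> [mf _]; rewrite /mean /Rintegral integral_dirac//.
  by rewrite diracE mem_set// mul1e.
exact/measurable_EFinP.
Qed.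

Lemma meanSE n (f : n.+1.-tuple T -> R) : bmeas f ->
  mean (mu0 ^^ n.+1) f = mean mu0 (fun y => mean (mu0 ^^ n) (slice f y)).
Proof.
move=> bf; rewrite -(mean_prod mu0 (mu0 ^^ n) (bmeas_slice2 bf)).
apply: EFin_inj; rewrite EFin_mean// EFin_mean; last exact: bmeas_slice2.
rewrite /= integral_distribution//; first by apply/measurable_EFinP; case: bf.
exact: (bmeas_integrable (mu0 \x mu0 ^^ n)%E (bmeas_slice2 bf)).
Qed.

End tuples.

Ltac bmeas_tac := repeat (first
  [ assumption | exact: bmeas_cst | apply: bmeasN | apply: bmeasD
  | apply: bmeasX | apply: bmeasM | apply: bmeas_expR | apply: bmeas_slice
  | apply: bmeas_mean_slice ]).

(** * Variance *)

Section variance.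
Context {R : realType} d (T : measurableType d) (P : probability T R).
Implicit Types f g : T -> R.

Lemma var_ge0 f : 0 <= var P f.
Proof. by apply: mean_ge0 => x; exact: sqr_ge0. Qed.

Lemma mean_sqr_shift f c : bmeas f ->
  mean P (fun x => (f x - c) ^+ 2) = var P f + (mean P f - c) ^+ 2.
Proof.
move=> bf; have key b : mean P (fun x => (f x - b) ^+ 2) =
    mean P (fun x => f x ^+ 2) - 2 * b * mean P f + b ^+ 2.
  rewrite (@eq_mean _ _ _ _ _ (fun x => f x ^+ 2 - 2 * b * f x + b ^+ 2)).
    by rewrite meanD ?meanB ?meanZ ?mean_cst//; bmeas_tac.
  by move=> x; ring.
by rewrite /var !key; ring.
Qed.

Lemma varE f : bmeas f ->
  var P f = mean P (fun x => f x ^+ 2) - mean P f ^+ 2.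
Proof.
move=> bf; have := mean_sqr_shift 0 bf.
by under eq_mean do rewrite subr0; move=> ->; rewrite subr0 addrK.
Qed.

Lemma var_le_mean_sqr f c : bmeas f ->
  var P f <= mean P (fun x => (f x - c) ^+ 2).
Proof. by move=> bf; rewrite mean_sqr_shift// lerDl sqr_ge0. Qed.

Lemma var_shift f c : bmeas f -> var P (fun x => c + f x) = var P f.
Proof.
move=> bf; rewrite /var meanD ?mean_cst; [|bmeas_tac..].
by apply: eq_mean => x; ring.
Qed.

Lemma var_cst c : var P (fun=> c) = 0.
Proof. by rewrite varE ?mean_cst ?subrr//; bmeas_tac. Qed.

Lemma varZ f c : bmeas f -> var P (fun x => c * f x) = c ^+ 2 * var P f.
Proof.
move=> bf; rewrite /var meanZ// -[RHS]meanZ; last by bmeas_tac.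
by apply: eq_mean => x; ring.
Qed.

Lemma cauchy_schwarz f g : bmeas f -> bmeas g ->
  mean P (fun x => f x * g x) ^+ 2 <=
  mean P (fun x => f x ^+ 2) * mean P (fun x => g x ^+ 2).
Proof.
move=> bf bg; set a := mean _ _; set b := mean _ _; set c := mean _ _.
have quad r s : 0 <= r ^+ 2 * b - 2 * r * s * a + s ^+ 2 * c.
  have <- : mean P (fun x => r ^+ 2 * f x ^+ 2 - 2 * r * s * (f x * g x) +
      s ^+ 2 * g x ^+ 2) = r ^+ 2 * b - 2 * r * s * a + s ^+ 2 * c.
    by rewrite meanD ?meanB ?meanZ//; bmeas_tac.
  apply: mean_ge0 => x.
  by rewrite (_ : _ + _ = (r * f x - s * g x) ^+ 2) ?sqr_ge0//; ring.
have [c0|c0] := eqVneq c 0.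
  have b0 : 0 <= b by apply: mean_ge0 => x; exact: sqr_ge0.
  (* For r = a and s = (b + 1) / 2 the quadratic form equals - a ^+ 2. *)
  by have := quad a ((b + 1) / 2); rewrite c0 mulr0 addr0; nra.
have {}c0 : 0 < c by rewrite lt_def c0 mean_ge0// => x; exact: sqr_ge0.
by have := quad c a; nra.
Qed.

Lemma varD f g : bmeas f -> bmeas g ->
  var P (fun x => f x + g x) = var P f + var P g +
    2 * mean P (fun x => (f x - mean P f) * (g x - mean P g)).
Proof.
move=> bf bg; rewrite [LHS](@eq_mean _ _ _ _ _ (fun x => (f x - mean P f) ^+ 2 +
    (g x - mean P g) ^+ 2 + 2 * ((f x - mean P f) * (g x - mean P g)))).
  by rewrite meanD ?meanD ?meanZ//; bmeas_tac.
by move=> x; rewrite meanD//; ring.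
Qed.

(** Minkowski's inequality for the standard deviation. *)
Lemma var_sqrtD f g : bmeas f -> bmeas g ->
  var P (fun x => f x + g x) <=
  (Num.sqrt (var P f) + Num.sqrt (var P g)) ^+ 2.
Proof.
move=> bf bg; rewrite varD// sqrrD !sqr_sqrtr; [|exact: var_ge0..].
rewrite [leRHS]addrAC lerD2l.
rewrite -[leRHS]mulr_natl ler_pM2l ?ltr0n//.
apply: le_trans (ler_norm _) _.
rewrite -sqrtr_sqr -sqrtrM; last exact: var_ge0.
by apply: ler_wsqrtr; apply: cauchy_schwarz; bmeas_tac.
Qed.

(** The difference of two variances is the covariance of the difference and
    the sum. *)
Lemma var_diff_le f g a b : bmeas f -> bmeas g -> 0 <= a -> 0 <= b ->
  var P (fun x => f x - g x) <= a ^+ 2 ->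
  var P (fun x => f x + g x) <= b ^+ 2 ->
  `|var P f - var P g| <= a * b.
Proof.
move=> bf bg a0 b0 va vb.
have -> : var P f - var P g = mean P (fun x =>
    (f x - g x - mean P (fun x => f x - g x)) *
    (f x + g x - mean P (fun x => f x + g x))).
  rewrite meanB// meanD// /var -[LHS]meanB; [|bmeas_tac..].
  by apply: eq_mean => x; ring.
rewrite -sqrtr_sqr -[leRHS]ger0_norm ?mulr_ge0// -[leRHS]sqrtr_sqr.
apply: ler_wsqrtr; apply: (le_trans (cauchy_schwarz _ _)); [bmeas_tac..|].
by rewrite exprMn ler_pM// mean_ge0// => x; exact: sqr_ge0.
Qed.

(** Popoviciu's inequality: the midpoint of the range is within b / 2 of all
    values. *)
Lemma var_range f b : bmeas f -> (forall x y, `|f x - f y| <= b) ->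
  var P f <= b ^+ 2 / 4.
Proof.
move=> bf fb; have [_ [M fM]] := bf.
have [[x0 _]|noT] := pselect (exists x : T, True); last first.
  have -> : f = fun=> 0.
    by apply/funext => x; exfalso; apply: noT; exists x.
  by rewrite var_cst mulr_ge0// sqr_ge0.
pose A := range f.
have hA : has_sup A.
  split; first by exists (f x0), x0.
  by exists M => _ [x _ <-]; exact: le_trans (ler_norm _) (fM x).
have supb x : f x <= sup A by apply: ub_le_sup; [exact: hA.2|exists x].
have bsup x : sup A - b <= f x.
  rewrite lerBlDr; apply: ge_sup; first exact: hA.1.
  by move=> _ [y _ <-]; rewrite -lerBlDl (le_trans (ler_norm _)).
apply: (le_trans (var_le_mean_sqr (sup A - b / 2) bf)).
apply: mean_le => [|x]; first by bmeas_tac.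
by have := supb x; have := bsup x; nra.
Qed.

(** The hypothesis on f says that its square root lies in an interval of length
    2 * r.  The product of the distances of f x to the two ends of the interval
    for f is nonnegative, and its mean is the claim up to a square. *)
Lemma var_self_bound f al r : bmeas f -> 0 <= al -> 0 <= r ->
  (forall x, al ^+ 2 <= f x <= (al + 2 * r) ^+ 2) ->
  var P f <= 4 * r ^+ 2 * mean P f.
Proof.
move=> bf al0 r0 fr; set be := al + 2 * r.
have : mean P (fun x => f x ^+ 2) <=
    mean P (fun x => (al ^+ 2 + be ^+ 2) * f x - al ^+ 2 * be ^+ 2).
  apply: le_mean; [bmeas_tac..|move=> x].
  have /andP[h1 h2] := fr x.
  have : 0 <= (be ^+ 2 - f x) * (f x - al ^+ 2) by rewrite mulr_ge0// subr_ge0.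
  by nra.
rewrite meanB ?meanZ ?mean_cst; [|bmeas_tac..]; move=> h.
rewrite varE//; have := sqr_ge0 (mean P f - al * be).
by move: h; rewrite /be; nra.
Qed.

End variance.

(** * Elementary bounds on the exponential *)

Section exponential.
Context {R : realType}.
Implicit Types a b c x e : R.

(** Since (k + 2)! >= 2 * 3^k, the terms of degree at least two of the
    exponential series are dominated by x^2 / 2 times a geometric series. *)
Lemma expR_quad x c : `|x| <= c -> c < 3 ->
  expR x <= 1 + x + x ^+ 2 / (2 * (1 - c / 3)).
Proof.
move=> xc c3; have c0 : 0 <= c by exact: le_trans xc.
pose r := c / 3; have r0 : 0 <= r by rewrite /r; lra.
have r1 : 0 < 1 - r by rewrite /r; lra.
have fact_ge N : 2 * 3 ^+ N <= (N.+2)`!%:R :> R.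
  elim: N => [|N IHN]; first by rewrite expr0 mulr1.
  rewrite factS natrM exprS mulrCA ler_pM// ?ler_nat//.
have partial N : series (exp_coeff x) N.+2 <=
    1 + x + x ^+ 2 / 2 * ((1 - r ^+ N) / (1 - r)).
  elim: N => [|N IHN].
    rewrite expr0 subrr mul0r mulr0 addr0 /series/= !big_nat_recr//= big_geq//.
    by rewrite /exp_coeff/= expr0 expr1 fact0 factS fact0 !divr1 add0r.
  rewrite seriesSr/=.
  apply: (le_trans (lerD IHN (_ : _ <= x ^+ 2 / 2 * r ^+ N))).
    rewrite /exp_coeff/= ler_pdivrMr ?ltr0n ?fact_gt0//.
    apply: (@le_trans _ _ (x ^+ 2 * c ^+ N)).
      rewrite -add2n exprD ler_wpM2l ?sqr_ge0//.
      rewrite (le_trans (ler_norm _))// normrX.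
      by rewrite lerXn2r// nnegrE.
    rewrite /r expr_div_n [leRHS](_ : _ =
        x ^+ 2 * c ^+ N * ((N.+2)`!%:R / (2 * 3 ^+ N))); last first.
      by field; rewrite expf_neq0.
    apply: ler_peMr; first by rewrite mulr_ge0 ?sqr_ge0 ?exprn_ge0.
    by rewrite ler_pdivlMr ?mul1r// mulr_gt0 ?exprn_gt0.
  rewrite le_eqVlt; apply/orP; left; apply/eqP.
  rewrite (exprS r N); clearbody r; move: (r ^+ N) (x ^+ 2 / 2) => p q.
  by field; rewrite gt_eqF.
have bound N : series (exp_coeff x) N.+2 <= 1 + x + x ^+ 2 / (2 * (1 - r)).
  apply: (le_trans (partial N)); rewrite lerD2l invfM [leRHS]mulrA.
  apply: ler_wpM2l; first by rewrite mulr_ge0// sqr_ge0.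
  by rewrite ler_pdivrMr// mulVf ?gt_eqF// gerBl exprn_ge0.
rewrite /expR; apply: limr_le; first exact: is_cvg_series_exp_coeff.
near=> N; have -> : N = (N - 2).+2; last exact: bound.
by rewrite -addn2 subnK//; near: N; exists 2%N.
Unshelve. all: by end_near. Qed.

Lemma expR_convex a b e : 0 <= e <= 1 ->
  expR ((1 - e) * a + e * b) <= (1 - e) * expR a + e * expR b.
Proof.
move=> /andP[e0 e1].
have := convex_expR (Itv01 e0 e1) b a.
by rewrite !convRE/= addrC [leRHS]addrC.
Qed.

End exponential.

(** * The predictable quadratic variation *)

Section quadratic_variation.
Context {R : realType} d (T : measurableType d) (mu0 : probability T R).

Local Notation "mu0 ^^ n" := (power_probability mu0 n) (at level 30).

Lemma bmeas_var_slice n (f : n.+1.-tuple T -> R) : bmeas f ->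
  bmeas (fun y => var (mu0 ^^ n) (slice f y)).
Proof.
move=> bf; rewrite (_ : (fun y => _) = fun y =>
    mean (mu0 ^^ n) (slice (fun x => f x ^+ 2) y) -
    mean (mu0 ^^ n) (slice f y) ^+ 2); first by bmeas_tac.
by apply/funext => y; rewrite varE//; bmeas_tac.
Qed.

(** The law of total variance. *)
Lemma varSE n (f : n.+1.-tuple T -> R) : bmeas f ->
  var (mu0 ^^ n.+1) f = var mu0 (fun y => mean (mu0 ^^ n) (slice f y)) +
    mean mu0 (fun y => var (mu0 ^^ n) (slice f y)).
Proof.
move=> bf; rewrite varE// (varE mu0 (bmeas_mean_slice mu0 bf)) -!meanSE//.
rewrite [X in X - _]meanSE; last by bmeas_tac.
rewrite addrAC -meanD; [|bmeas_tac|exact: bmeas_var_slice].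
congr (_ - _); apply: eq_mean => y; rewrite varE; last by bmeas_tac.
by rewrite subrKC.
Qed.

(** The predictable quadratic variation of the martingale that reveals the
    arguments of f from left to right. *)
Fixpoint qvar n : (n.-tuple T -> R) -> n.-tuple T -> R :=
  match n with
  | 0 => fun _ _ => 0
  | k.+1 => fun f x => var mu0 (fun y => mean (mu0 ^^ k) (slice f y)) +
                       qvar (slice f (thead x)) (behead_tuple x)
  end.

Lemma slice_qvar n (f : n.+1.-tuple T -> R) y :
  slice (qvar f) y = fun s =>
    var mu0 (fun y => mean (mu0 ^^ n) (slice f y)) + qvar (slice f y) s.
Proof. by apply/funext => s; rewrite /slice /= behead_cons_tuple. Qed.

Lemma qvar_ge0 n (f : n.-tuple T -> R) x : 0 <= qvar f x.
Proof.
elim: n f x => [//|n IHn] f x /=.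
by rewrite addr_ge0 ?var_ge0.
Qed.

(** The parameter z makes the induction go through: fixing the first argument
    of f turns it into a parameter. *)
Lemma bmeas_qvar_param n d' (Z : measurableType d')
    (F : Z * n.-tuple T -> R) : bmeas F ->
  bmeas (fun z => qvar (fun s => F (z.1, s)) z.2).
Proof.
elim: n d' Z F => [|n IHn] d' Z F bF /=; first exact: bmeas_cst.
have bF1 : bmeas (fun w : (Z * T) * n.-tuple T =>
    F (w.1.1, cons_tuple w.1.2 w.2)).
  apply: (bmeas_comp _ bF); apply/measurable_fun_pairP; split.
    exact: (measurableT_comp measurable_fst measurable_fst).
  apply: (measurable_cons (f := fun w : (Z * T) * n.-tuple T => w.1.2)
    (g := snd)) => //.
  exact: (measurableT_comp measurable_snd measurable_fst).
apply: bmeasD.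
  apply: (bmeas_comp measurable_fst (f := fun z => var mu0
    (fun y => mean (mu0 ^^ n) (slice (fun s => F (z, s)) y)))).
  have bm : bmeas (fun w : Z * T => mean (mu0 ^^ n)
    (fun s => F (w.1, cons_tuple w.2 s))) by exact: bmeas_mean bF1.
  rewrite (_ : (fun z => _) = fun z => mean mu0 (fun y => mean (mu0 ^^ n)
      (fun s => F (z, cons_tuple y s)) ^+ 2) -
      mean mu0 (fun y => mean (mu0 ^^ n)
        (fun s => F (z, cons_tuple y s))) ^+ 2).
    apply: bmeasB; last by apply: bmeasX; exact: (bmeas_mean mu0 bm).
    exact: (bmeas_mean mu0 (bmeasX 2 bm)).
  apply/funext => z; rewrite varE//.
  exact: (bmeas_slicel z bm).
have := IHn _ _ _ bF1.
apply: (bmeas_comp (h := fun z : Z * n.+1.-tuple T =>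
  ((z.1, thead z.2), behead_tuple z.2))).
apply/measurable_fun_pairP; split => /=.
  apply/measurable_fun_pairP; split => /=; first exact: measurable_fst.
  exact: (measurableT_comp (measurable_tnth ord0) measurable_snd).
exact: (measurableT_comp (@measurable_behead _ _ _) measurable_snd).
Qed.

Lemma bmeas_qvar n (f : n.-tuple T -> R) : bmeas f -> bmeas (qvar f).
Proof.
case: n f => [|n] f bf; first exact: bmeas_cst.
apply: bmeasD; first exact: bmeas_cst.
exact: bmeas_uncurry (bmeas_qvar_param (bmeas_slice2 bf)).
Qed.

(** The martingale increments are orthogonal: their mean squares add up to the
    variance. *)
Lemma mean_qvar n (f : n.-tuple T -> R) : bmeas f ->
  mean (mu0 ^^ n) (qvar f) = var (mu0 ^^ n) f.
Proof.
elim: n f => [|n IHn] f bf.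
  rewrite mean_cst varE// mean0E; last by bmeas_tac.
  by rewrite mean0E// subrr.
rewrite meanSE; last exact: bmeas_qvar.
rewrite varSE// -[X in X + _](mean_cst mu0) -meanD.
- apply: eq_mean => y; rewrite slice_qvar meanD ?mean_cst ?IHn//.
  + by bmeas_tac.
  + by bmeas_tac.
  + by apply: bmeas_qvar; bmeas_tac.
- by bmeas_tac.
- exact: bmeas_var_slice.
Qed.

Lemma qvar_shift n (f : n.-tuple T -> R) c : bmeas f ->
  qvar (fun x => c + f x) = qvar f.
Proof.
elim: n f => [//|n IHn] f bf.
apply/funext => x; apply: (f_equal2 (fun a b : R => a + b)).
  rewrite -[RHS](var_shift _ c); last by bmeas_tac.
  congr var; apply/funext => y.
  have -> : slice (fun x => c + f x) y = fun s => c + slice f y s by [].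
  by rewrite meanD ?mean_cst//; bmeas_tac.
exact: (congr1 (fun h => h (behead_tuple x))
  (IHn _ (bmeas_slice (thead x) bf))).
Qed.

End quadratic_variation.

(* Slices come first: the closure lemmas would unfold them and lose their
   head symbol. *)
Ltac bmeas_tac ::= repeat (first
  [ assumption | exact: bmeas_cst | apply: bmeas_slice | apply: bmeas_mean_slice
  | apply: bmeas_qvar | apply: bmeas_var_slice | apply: bmeasN | apply: bmeasD
  | apply: bmeasX | apply: bmeasM | apply: bmeas_expR ]).

(** * Sensitivity of a function to its arguments *)

Section sensitivity.
Context {R : realType} d (T : measurableType d) (mu0 : probability T R).

Local Notation "mu0 ^^ n" := (power_probability mu0 n) (at level 30).

(** Like the two notions that follow it, bdiff is defined by recursion on the
    arguments, so that it is inherited by slices; it bounds the effect of a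
    change of any one argument. *)
Fixpoint bdiff n (b : R) : (n.-tuple T -> R) -> Prop :=
  match n with
  | 0 => fun _ => True
  | k.+1 => fun f => (forall y y' s, `|slice f y s - slice f y' s| <= b) /\
                     (forall y, bdiff b (slice f y))
  end.

(** Up to a function that does not depend on it, f depends on an argument only
    through a part that is insensitive, at scale i, to the later arguments.
    Bounding mixed second differences instead would cost a factor two when such
    a part is extracted from f. *)
Fixpoint interaction n (i : R) : (n.-tuple T -> R) -> Prop :=
  match n with
  | 0 => fun _ => True
  | k.+1 => fun f =>
      (exists c, bmeas c /\ forall y, bdiff i (fun s => slice f y s - c s)) /\
      (forall y, interaction i (slice f y))
  end.

(** These are the increments of the martingale that reveals the arguments from
    left to right. *)
Fixpoint increments n (b : R) : (n.-tuple T -> R) -> Prop :=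
  match n with
  | 0 => fun _ => True
  | k.+1 => fun f =>
      (forall y y', `|mean (mu0 ^^ k) (slice f y) -
                      mean (mu0 ^^ k) (slice f y')| <= b) /\
      (forall y, increments b (slice f y))
  end.

Lemma bdiffD n b c (f g : n.-tuple T -> R) : bdiff b f -> bdiff c g ->
  bdiff (b + c) (fun x => f x + g x).
Proof.
elim: n f g => [//|n IHn] f g [f1 f2] [g1 g2]; split => [y y' s|y].
  rewrite /slice opprD addrACA (le_trans (ler_normD _ _))//.
  by rewrite lerD//; [exact: f1|exact: g1].
exact: (IHn _ _ (f2 y) (g2 y)).
Qed.

Lemma bdiffZ n b c (f : n.-tuple T -> R) : bdiff b f ->
  bdiff (`|c| * b) (fun x => c * f x).
Proof.
elim: n f => [//|n IHn] f [f1 f2]; split => [y y' s|y].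
  by rewrite /slice -mulrBr normrM ler_wpM2l//; exact: f1.
exact: (IHn _ (f2 y)).
Qed.

Lemma bdiffB n b c (f g : n.-tuple T -> R) : bdiff b f -> bdiff c g ->
  bdiff (b + c) (fun x => f x - g x).
Proof.
move=> bf /(bdiffZ (- 1)); rewrite normrN1 mul1r => /(bdiffD bf).
rewrite (_ : (fun x => f x + -1 * g x) = fun x => f x - g x)//.
by apply/funext => x; rewrite mulN1r.
Qed.

Lemma bdiff_mean n b d' (Z : measurableType d') (P : probability Z R)
    (F : Z * n.-tuple T -> R) : bmeas F ->
  (forall z, bdiff b (fun s => F (z, s))) ->
  bdiff b (fun s => mean P (fun z => F (z, s))).
Proof.
elim: n F => [//|n IHn] F bF Fb; split => [y y' s|y].
  rewrite /slice -meanB; [|exact: bmeas_slicer..].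
  apply: ler_norm_mean => [|z]; last exact: (Fb z).1.
  by apply: bmeasB; exact: bmeas_slicer.
apply: (IHn (fun w => F (w.1, cons_tuple y w.2))) => [|z]; last exact: (Fb z).2.
apply: (bmeas_comp _ bF); apply/measurable_fun_pairP; split.
  exact: measurable_fst.
exact: (measurable_cons (measurable_cst y) measurable_snd).
Qed.

Lemma interactionD n i j (f g : n.-tuple T -> R) :
  interaction i f -> interaction j g ->
  interaction (i + j) (fun x => f x + g x).
Proof.
elim: n f g => [//|n IHn] f g [[c [bc fc]] f2] [[e [be ge]] g2].
split => [|y]; last exact: (IHn _ _ (f2 y) (g2 y)).
exists (fun s => c s + e s); split => [|y]; first exact: bmeasD.
rewrite (_ : (fun s => _) = fun s =>
    (slice f y s - c s) + (slice g y s - e s)); first exact: bdiffD.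
by apply/funext => s; rewrite addrACA -opprD.
Qed.

Lemma interactionZ n i c (f : n.-tuple T -> R) : interaction i f ->
  interaction (`|c| * i) (fun x => c * f x).
Proof.
elim: n f => [//|n IHn] f [[e [be fe]] f2].
split => [|y]; last exact: (IHn _ (f2 y)).
exists (fun s => c * e s); split => [|y]; first by bmeas_tac.
rewrite (_ : (fun s => _) = fun s => c * (slice f y s - e s)).
  exact: bdiffZ.
by apply/funext => s; rewrite mulrBr.
Qed.

Lemma increments_shift n b c (f : n.-tuple T -> R) : bmeas f ->
  increments b f -> increments b (fun x => c + f x).
Proof.
elim: n f => [//|n IHn] f bf [f1 f2]; split => [y y'|y]; last first.
  exact: (IHn _ (bmeas_slice y bf) (f2 y)).
have E z : mean (mu0 ^^ n) (slice (fun x => c + f x) z) =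
    c + mean (mu0 ^^ n) (slice f z).
  by rewrite -[X in X + _](mean_cst (mu0 ^^ n)) -meanD//; bmeas_tac.
by rewrite !E opprD addrACA subrr add0r.
Qed.

Lemma le_increments n b c (f : n.-tuple T -> R) : b <= c ->
  increments b f -> increments c f.
Proof.
move=> bc; elim: n f => [//|n IHn] f [f1 f2]; split => [y y'|y].
  exact: le_trans (f1 y y') bc.
exact: (IHn _ (f2 y)).
Qed.

Lemma bdiff_increments n b (f : n.-tuple T -> R) : bmeas f ->
  bdiff b f -> increments b f.
Proof.
elim: n f => [//|n IHn] f bf [f1 f2]; split => [y y'|y]; last first.
  exact: (IHn _ (bmeas_slice y bf) (f2 y)).
rewrite -meanB; [|bmeas_tac..].
by apply: ler_norm_mean => [|s]; [bmeas_tac|exact: f1].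
Qed.

(** The Efron-Stein inequality for bounded differences. *)
Lemma var_bdiff n b (f : n.-tuple T -> R) : bmeas f -> bdiff b f ->
  var (mu0 ^^ n) f <= n%:R * (b ^+ 2 / 4).
Proof.
elim: n f => [|n IHn] f bf.
  by rewrite varE// !mean0E; [rewrite subrr mul0r|bmeas_tac..].
move=> fb; have [_ f2] := fb.
rewrite varSE// -natr1 mulrDl mul1r addrC; apply: lerD.
  apply: mean_le => [|y]; first exact: bmeas_var_slice.
  exact: (IHn _ (bmeas_slice y bf) (f2 y)).
apply: var_range; first by bmeas_tac.
exact: (bdiff_increments bf fb).1.
Qed.

End sensitivity.

(** * Exponential inequality for a martingale and its quadratic variation *)

Section exponential_martingale.
Context {R : realType} d (T : measurableType d) (mu0 : probability T R).

Local Notation "mu0 ^^ n" := (power_probability mu0 n) (at level 30).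

(** Freedman's inequality.  The increment of the martingale when the first
    argument is revealed is centered and bounded by b, so that its exponential
    moment is at most the exponential of its variance; the later increments
    are handled by induction conditionally on the first argument. *)
Lemma freedman n (f : n.-tuple T -> R) (b l : R) :
  bmeas f -> increments mu0 b f -> 0 <= l -> l * b < 3 ->
  mean (mu0 ^^ n) (fun x => expR (l * (f x - mean (mu0 ^^ n) f) -
    l ^+ 2 / (2 * (1 - l * b / 3)) * qvar mu0 f x)) <= 1.
Proof.
move=> + + l0 lb; set phi := l ^+ 2 / _.
have phi0 : 0 <= phi by rewrite divr_ge0 ?sqr_ge0// mulr_ge0//; lra.
elim: n f => [|n IHn] f bf.
  rewrite (mean0E _ bf) mean0E /=; first by rewrite subrr !mulr0 subr0 expR0.
  by bmeas_tac.
move=> [f1 f2]; rewrite [leLHS]meanSE; last by bmeas_tac.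
pose m y := mean (mu0 ^^ n) (slice f y).
have bm : bmeas m by rewrite /m; bmeas_tac.
have -> : mean (mu0 ^^ n.+1) f = mean mu0 m by exact: meanSE.
have md y : `|m y - mean mu0 m| <= b.
  rewrite -[X in X - _](mean_cst mu0) -meanB; [|bmeas_tac..].
  by apply: ler_norm_mean => [|y']; [bmeas_tac|exact: f1].
apply: (@le_trans _ _ (mean mu0 (fun y =>
    (1 + l * (m y - mean mu0 m) + phi * (m y - mean mu0 m) ^+ 2) *
    expR (- (phi * var mu0 m))))).
  apply: le_mean; [by bmeas_tac|by bmeas_tac|move=> y].
  apply: (@le_trans _ _ (expR (l * (m y - mean mu0 m)) *
      expR (- (phi * var mu0 m)))); last first.
    rewrite ler_pM2r ?expR_gt0//.
    have lmb : `|l * (m y - mean mu0 m)| <= l * b.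
      by rewrite normrM ger0_norm// ler_wpM2l.
    apply: (le_trans (expR_quad lmb lb)).
    by rewrite exprMn /phi mulrAC.
  rewrite -expRD -[leRHS]mulr1.
  apply: le_trans (ler_wpM2l (expR_ge0 _) (IHn _ (bmeas_slice y bf) (f2 y))).
  rewrite -meanZ; last by bmeas_tac.
  apply: le_mean; [by bmeas_tac|by bmeas_tac|move=> s].
  rewrite -expRD ler_expR /slice /= behead_cons_tuple.
  by rewrite -/(slice f y) -/(m y) /m; lra.
under eq_mean do rewrite mulrC.
rewrite meanZ; last by bmeas_tac.
rewrite meanD ?meanD ?meanZ ?meanB ?mean_cst; [|bmeas_tac..].
rewrite subrr mulr0 addr0 -/(var mu0 m) expRN ler_pdivrMl ?expR_gt0// mulr1.
exact: expR_ge1Dx.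
Qed.

(** Convexity of the exponential gives Hoelder's inequality for two functions
    that are normalized to have exponential moments at most 1. *)
Lemma mean_expR_convex d' (Z : measurableType d') (P : probability Z R)
    (A B : Z -> R) (e : R) : bmeas A -> bmeas B -> 0 <= e <= 1 ->
  mean P (fun z => expR (A z)) <= 1 -> mean P (fun z => expR (B z)) <= 1 ->
  mean P (fun z => expR ((1 - e) * A z + e * B z)) <= 1.
Proof.
move=> bA bB /[dup] e01 /andP[e0 e1] A1 B1.
apply: (@le_trans _ _ (mean P (fun z =>
    (1 - e) * expR (A z) + e * expR (B z)))).
  by apply: le_mean; [bmeas_tac..|move=> z; exact: expR_convex].
rewrite meanD ?meanZ; [|bmeas_tac..].
rewrite -[leRHS](subrK e) lerD//.
  by rewrite -[leRHS]mulr1 ler_wpM2l// subr_ge0.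
by rewrite -[leRHS]mulr1 ler_wpM2l.
Qed.

(** The cumulant generating function. *)
Definition cgf d' (Z : measurableType d') (P : probability Z R)
    (f : Z -> R) (s : R) :=
  ln (mean P (fun z => expR (s * f z))).

Lemma expR_cgf d' (Z : measurableType d') (P : probability Z R)
    (f : Z -> R) (s : R) :
  bmeas f -> expR (cgf P f s) = mean P (fun z => expR (s * f z)).
Proof.
move=> bf; rewrite /cgf lnK// posrE.
have [_ [M fM]] := bf.
apply: (@lt_le_trans _ _ (expR (- (`|s| * M)))); first exact: expR_gt0.
apply: le_mean_cst => [|z]; first by bmeas_tac.
rewrite ler_expR lerNl (le_trans (ler_norm _))// normrN normrM.
by rewrite ler_wpM2l.
Qed.

Lemma mean_expR_cgf d' (Z : measurableType d') (P : probability Z R)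
    (f : Z -> R) (s : R) :
  bmeas f -> mean P (fun z => expR (s * f z - cgf P f s)) <= 1.
Proof.
move=> bf; under eq_mean do rewrite expRB mulrC.
rewrite meanZ; last by bmeas_tac.
by rewrite -expR_cgf// mulVf// expR_eq0.
Qed.

(** Jensen's inequality for the concave power k. *)
Lemma cgf_scale d' (Z : measurableType d') (P : probability Z R)
    (f : Z -> R) (s k : R) :
  bmeas f -> 0 <= k <= 1 -> cgf P f (k * s) <= k * cgf P f s.
Proof.
move=> bf k01; rewrite -ler_expR expR_cgf//.
have := mean_expR_convex (P := P) (A := fun=> 0) (bmeas_cst _ 0)
  (bmeasB (bmeasM (bmeas_cst _ s) bf) (bmeas_cst _ (cgf P f s))) k01.
rewrite expR0 mean_cst => /(_ (lexx _) (mean_expR_cgf _ _ bf)) => h.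
rewrite -[leRHS]mulr1 -ler_pdivrMl ?expR_gt0// -expRN.
rewrite -[leLHS]meanZ; last by bmeas_tac.
apply: le_trans h; rewrite le_eqVlt; apply/orP; left; apply/eqP.
by apply: eq_mean => z; rewrite -expRD; congr expR; ring.
Qed.

(** Weighting the quadratic variation in and out again with Hoelder's
    inequality turns the exponential inequality into a bound that needs only
    the exponential moments of the quadratic variation. *)
Lemma cgf_le_qvar n (f : n.-tuple T -> R) (b l e : R) :
  bmeas f -> increments mu0 b f -> 0 <= l -> 0 < e -> 0 < 1 - e - l * b / 3 ->
  0 <= b ->
  cgf (mu0 ^^ n) f l <= l * mean (mu0 ^^ n) f +
    e * cgf (mu0 ^^ n) (qvar mu0 f) (l ^+ 2 / (2 * e * (1 - e - l * b / 3))).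
Proof.
move=> bf fb l0 e0 eb b0; set s := l ^+ 2 / _; set V := qvar mu0 f.
have bV : bmeas V by exact: bmeas_qvar.
have lb0 : 0 <= l * b / 3 by rewrite divr_ge0// mulr_ge0.
have e1 : 0 < 1 - e by lra.
have h1 : 0 <= l / (1 - e) by rewrite divr_ge0// ltW.
have h2 : l / (1 - e) * b < 3.
  by rewrite mulrAC ltr_pdivrMr//; lra.
have fr := freedman bf fb h1 h2; set phi := (l / (1 - e)) ^+ 2 / _ in fr.
have phiE : (1 - e) * phi = e * s.
  rewrite /phi /s; field.
  by rewrite !gt_eqF//; move: eb; rewrite -(ltr_pM2l (ltr0n R 3)); lra.
rewrite -ler_expR expR_cgf//.
have := mean_expR_convex (P := mu0 ^^ n) (e := e) _ _ _ fr
  (mean_expR_cgf (mu0 ^^ n) s bV).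
have e01 : 0 <= e <= 1 by lra.
have bA : bmeas (fun x => l / (1 - e) * (f x - mean (mu0 ^^ n) f) - phi * V x).
  by bmeas_tac.
have bB : bmeas (fun x => s * V x - cgf (mu0 ^^ n) V s) by bmeas_tac.
move=> /(_ bA bB e01) h.
rewrite -[leRHS]mulr1 -ler_pdivrMl ?expR_gt0// -expRN.
rewrite -[leLHS]meanZ; last by bmeas_tac.
apply: le_trans h; rewrite le_eqVlt; apply/orP; left; apply/eqP.
apply: eq_mean => x; rewrite -expRD; congr expR.
have -> : (1 - e) * (l / (1 - e) * (f x - mean (mu0 ^^ n) f) - phi * V x) =
    l * (f x - mean (mu0 ^^ n) f) - e * s * V x.
  by rewrite -phiE; field; rewrite gt_eqF.
ring.
Qed.

End exponential_martingale.

(** * Exponential moments of the quadratic variation *)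

Section bernstein.
Context {R : realType} d (T : measurableType d) (mu0 : probability T R).

Local Notation "mu0 ^^ n" := (power_probability mu0 n) (at level 30).

(** By Minkowski's inequality the standard deviations of all the slices lie
    within the same distance of that of the common part c. *)
Lemma var_var_slice n (f : n.+1.-tuple T -> R) (i : R) :
  bmeas f -> interaction i f -> 0 <= i ->
  var mu0 (fun y => var (mu0 ^^ n) (slice f y)) <=
  n%:R * i ^+ 2 * mean mu0 (fun y => var (mu0 ^^ n) (slice f y)).
Proof.
move=> bf [[c [bc fc]] _] i0.
pose r := Num.sqrt (n%:R * (i ^+ 2 / 4)); pose C := Num.sqrt (var (mu0 ^^ n) c).
have r2 : r ^+ 2 = n%:R * (i ^+ 2 / 4).
  by rewrite sqr_sqrtr// mulr_ge0// divr_ge0 ?sqr_ge0.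
have r0 : 0 <= r by exact: sqrtr_ge0.
have C0 : 0 <= C by exact: sqrtr_ge0.
have -> : n%:R * i ^+ 2 = 4 * r ^+ 2 by rewrite r2; field.
pose D y s := slice f y s - c s.
have bD y : bmeas (D y) by apply: bmeasB; [bmeas_tac|].
have sdD y : Num.sqrt (var (mu0 ^^ n) (D y)) <= r.
  by apply: ler_wsqrtr; apply: var_bdiff; [exact: bD|exact: fc].
apply: (@var_self_bound _ _ _ _ _ (Num.max 0 (C - r))) => //.
- exact: bmeas_var_slice.
- by rewrite le_max lexx.
move=> y; set S := var _ _; set al := Num.max _ _.
have al0 : 0 <= al by rewrite le_max lexx.
have S0 : 0 <= S by exact: var_ge0.
have up : S <= (r + C) ^+ 2.
  rewrite /S (_ : slice f y = fun s => D y s + c s); last first.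
    by apply/funext => s; rewrite subrK.
  apply: (le_trans (var_sqrtD _ (bD y) bc)).
  by rewrite lerXn2r ?nnegrE ?addr_ge0 ?sqrtr_ge0// lerD2r.
have lo : C <= Num.sqrt S + r.
  rewrite -(@ger0_norm _ (Num.sqrt S + r)) ?addr_ge0 ?sqrtr_ge0//.
  rewrite -sqrtr_sqr; apply: ler_wsqrtr.
  rewrite (_ : c = fun s => slice f y s + -1 * D y s); last first.
    by apply/funext => s; rewrite /D; ring.
  apply: (le_trans (var_sqrtD _ _ _)); [bmeas_tac|by have := bD y; bmeas_tac|].
  rewrite varZ// sqrrN expr1n mul1r.
  by rewrite lerXn2r ?nnegrE ?addr_ge0 ?sqrtr_ge0// lerD2l.
clearbody r C S.
have [al1 al2] : al <= Num.sqrt S /\ r + C <= al + 2 * r.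
  rewrite ge_max sqrtr_ge0 lerBlDr lo; split => //.
  have : C - r <= al by rewrite le_max lexx orbT.
  lra.
apply/andP; split.
  by rewrite -(sqr_sqrtr S0) lerXn2r ?nnegrE ?sqrtr_ge0.
apply: (le_trans up); apply: lerXn2r => //; rewrite nnegrE.
  exact: addr_ge0.
by apply: addr_ge0 => //; apply: mulr_ge0.
Qed.

(** Both exponentials increase with G, so the product of their differences
    from their values at the mean of G is nonnegative; the remaining term is
    bounded below by a tangent, whose mean vanishes. *)
Lemma expR_mean_le d' (Z : measurableType d') (P : probability Z R)
    (G : Z -> R) (a b : R) : bmeas G -> 0 <= a -> 0 <= b ->
  expR (a * mean P G) * mean P (fun z => expR (b * G z)) <=
  mean P (fun z => expR ((a + b) * G z)).
Proof.
move=> bG a0 b0; set m := mean P G.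
apply: (@le_trans _ _ (mean P (fun z => expR (a * m) * expR (b * G z) +
    expR ((a + b) * m) * (a * (G z - m))))).
  rewrite meanD ?meanZ ?meanB ?mean_cst; [|bmeas_tac..].
  by rewrite subrr !mulr0 addr0.
apply: le_mean; [bmeas_tac..|move=> z].
have h1 : 0 <= (expR (b * G z) - expR (b * m)) *
    (expR (a * G z) - expR (a * m)).
  have [Gm|/ltW Gm] := leP m (G z).
    by rewrite mulr_ge0// subr_ge0 ler_expR ler_wpM2l.
  by rewrite mulr_le0// subr_le0 ler_expR ler_wpM2l.
have h2 : expR (a * m) * (1 + a * (G z - m)) <= expR (a * G z).
  rewrite (_ : a * G z = a * m + a * (G z - m)); last by ring.
  by rewrite expRD ler_pM2l ?expR_gt0// expR_ge1Dx.
rewrite !mulrDl !expRD.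
have := ler_wpM2l (expR_ge0 (b * m)) h2.
by move: h1; lra.
Qed.

(** The quadratic variation of the quadratic variation is controlled by
    conditional expectations of the quadratic variation itself; the weights
    n * i^2 of the successive arguments add up to the constant below. *)
Lemma mean_expR_qvar2 n (f : n.-tuple T -> R) (i th : R) :
  bmeas f -> interaction i f -> 0 <= i -> 0 <= th ->
  mean (mu0 ^^ n) (fun x => expR (th * qvar mu0 (qvar mu0 f) x)) <=
  mean (mu0 ^^ n) (fun x =>
    expR (th * (n%:R * (n%:R - 1) / 2 * i ^+ 2) * qvar mu0 f x)).
Proof.
move=> + + i0 th0; elim: n f => [|n IHn] f bf fi.
  by rewrite /= !mulr0.
pose v0 := var mu0 (fun y => mean (mu0 ^^ n) (slice f y)).
pose w0 := var mu0 (fun y => var (mu0 ^^ n) (slice f y)).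
pose H x := qvar mu0 (slice f (thead x)) (behead_tuple x).
have qE x : qvar mu0 f x = v0 + H x by [].
have HE y : slice H y = qvar mu0 (slice f y).
  by apply/funext => s; rewrite /slice /H behead_cons_tuple.
have bH : bmeas H.
  rewrite (_ : H = fun x => qvar mu0 f x - v0); first by bmeas_tac.
  by apply/funext => x; rewrite qE addrC addKr.
have mH : mean (mu0 ^^ n.+1) H = mean mu0 (fun y => var (mu0 ^^ n) (slice f y)).
  rewrite meanSE//; apply: eq_mean => y.
  by rewrite HE mean_qvar//; bmeas_tac.
have qqE x : qvar mu0 (qvar mu0 f) x =
    w0 + qvar mu0 (qvar mu0 (slice f (thead x))) (behead_tuple x).
  have qs y : slice (qvar mu0 f) y = fun s => v0 + qvar mu0 (slice f y) s.
    by rewrite slice_qvar.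
  rewrite [LHS]/=; apply: (f_equal2 (fun a b : R => a + b)).
    rewrite /w0 -[RHS](var_shift _ v0); last exact: bmeas_var_slice.
    congr var; apply/funext => y.
    by rewrite qs meanD ?mean_cst ?mean_qvar//; bmeas_tac.
  by rewrite qs qvar_shift//; bmeas_tac.
have bQ : bmeas (fun x : n.+1.-tuple T =>
    qvar mu0 (qvar mu0 (slice f (thead x))) (behead_tuple x)).
  rewrite (_ : (fun x => _) = fun x => qvar mu0 (qvar mu0 f) x - w0).
    by bmeas_tac.
  by apply/funext => x; rewrite qqE addrC addKr.
set a := n%:R * (n%:R - 1) / 2 * i ^+ 2 in IHn.
have a0 : 0 <= a.
  rewrite /a mulr_ge0 ?sqr_ge0// divr_ge0//.
  by case: (n) => [|k]; rewrite ?mul0r// mulr_ge0// subr_ge0 ler1n.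
have -> : n.+1%:R * (n.+1%:R - 1) / 2 * i ^+ 2 = n%:R * i ^+ 2 + a.
  by rewrite /a -natr1; field.
have [_ fi2] := fi.
apply: (@le_trans _ _ (expR (th * (n%:R * i ^+ 2) * mean (mu0 ^^ n.+1) H) *
    mean (mu0 ^^ n.+1) (fun x => expR (th * a * H x)))); last first.
  have ci0 : 0 <= th * (n%:R * i ^+ 2) by rewrite !mulr_ge0 ?sqr_ge0.
  apply: (le_trans (expR_mean_le _ bH ci0 (mulr_ge0 th0 a0))).
  apply: le_mean; [bmeas_tac..|move=> x].
  rewrite ler_expR -mulrDr ler_wpM2l//.
    by rewrite mulr_ge0// addr_ge0// mulr_ge0 ?sqr_ge0.
  by rewrite qE lerDr var_ge0.
under eq_mean do rewrite qqE mulrDr expRD.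
rewrite meanZ; last by bmeas_tac.
apply: ler_pM; rewrite ?expR_ge0//.
- by apply: mean_ge0 => x; exact: expR_ge0.
- by rewrite ler_expR -mulrA ler_wpM2l// mH; exact: var_var_slice.
rewrite meanSE; last by bmeas_tac.
rewrite [leRHS]meanSE; last by bmeas_tac.
apply: le_mean; [bmeas_tac..|move=> y].
have -> : slice (fun x => expR (th * a * H x)) y =
    fun s => expR (th * a * qvar mu0 (slice f y) s) by rewrite -HE.
have -> : slice (fun x : n.+1.-tuple T => expR (th *
      qvar mu0 (qvar mu0 (slice f (thead x))) (behead_tuple x))) y =
    fun s => expR (th * qvar mu0 (qvar mu0 (slice f y)) s).
  by apply/funext => s; rewrite /slice behead_cons_tuple.
exact: (IHn _ (bmeas_slice y bf) (fi2 y)).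
Qed.

(** Revealing one more argument changes the conditional mean of the quadratic
    variation by a difference of two conditional variances of f.  The two
    slices of f differ by a function with differences i + i, and their sum has
    differences b + b. *)
Lemma increments_qvar n N (f : n.-tuple T -> R) (b i : R) : (n <= N)%N ->
  bmeas f -> bdiff b f -> interaction i f -> 0 <= b -> 0 <= i ->
  increments mu0 (N%:R * (i * b)) (qvar mu0 f).
Proof.
move=> + + + + b0 i0; elim: n f => [//|n IHn] f nN bf fb fi.
pose v0 := var mu0 (fun y => mean (mu0 ^^ n) (slice f y)).
have qs y : slice (qvar mu0 f) y = fun s => v0 + qvar mu0 (slice f y) s.
  by rewrite slice_qvar.
have [fb1 fb2] := fb; have [[c [bc fc]] fi2] := fi.
split => [y y'|y]; last first.
  change (increments mu0 (N%:R * (i * b)) (slice (qvar mu0 f) y)).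
  rewrite qs; apply: increments_shift; first by bmeas_tac.
  exact: (IHn _ (ltnW nN) (bmeas_slice y bf) (fb2 y) (fi2 y)).
rewrite !qs !meanD ?mean_cst ?mean_qvar; [|bmeas_tac..].
rewrite opprD addrACA subrr add0r.
apply: (@le_trans _ _ (n%:R * (i * b))); last first.
  by rewrite ler_wpM2r ?mulr_ge0// ler_nat ltnW.
have sq (z : R) : n%:R * ((z + z) ^+ 2 / 4) = (Num.sqrt n%:R * z) ^+ 2.
  by rewrite exprMn sqr_sqrtr//; field.
have -> : n%:R * (i * b) = (Num.sqrt n%:R * i) * (Num.sqrt n%:R * b).
  by rewrite mulrACA -expr2 sqr_sqrtr.
apply: var_diff_le; [bmeas_tac|bmeas_tac|by rewrite mulr_ge0 ?sqrtr_ge0..| |].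
  rewrite -sq; apply: var_bdiff; first by apply: bmeasB; bmeas_tac.
  rewrite (_ : (fun s => _) = fun s =>
    (slice f y s - c s) - (slice f y' s - c s)); first exact: bdiffB.
  by apply/funext => s; ring.
rewrite -sq; apply: var_bdiff; first by bmeas_tac.
exact: (bdiffD (fb2 y) (fb2 y')).
Qed.

(** The exponential inequality, applied to the quadratic variation V of f:
    the exponential moments of V at s are bounded in terms of those at a
    smaller argument, which Jensen's inequality reduces to those at s. *)
Lemma cgf_qvar n (f : n.-tuple T -> R) (b i q s : R) :
  bmeas f -> bdiff b f -> interaction i f -> 0 <= b -> 0 <= i ->
  n%:R * (n%:R - 1) / 2 * i ^+ 2 <= 2 * q ^+ 2 ->
  n%:R * (i * b) <= 2 * q ^+ 2 ->
  0 <= s -> 2 * q ^+ 2 * s <= 3 / 8 ->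
  (1 - 4 / 3 * (2 * q ^+ 2 * s)) * cgf (mu0 ^^ n) (qvar mu0 f) s <=
  s * var (mu0 ^^ n) f.
Proof.
move=> bf fb fi b0 i0 hA hB s0; set x := 2 * q ^+ 2 * s => x38.
have bV : bmeas (qvar mu0 f) by bmeas_tac.
have x0 : 0 <= x by rewrite /x mulr_ge0// mulr_ge0// sqr_ge0.
have hx0 : 0 < 1 / 2 - x / 3 by lra.
have k01 : 0 <= 8 / 3 * x <= 1 by lra.
have inc := le_increments hB (increments_qvar (leqnn n) bf fb fi b0 i0).
have hx : 1 - 2^-1 - s * (2 * q ^+ 2) / 3 = 1 / 2 - x / 3 by rewrite /x; field.
have half0 : 0 < 2^-1 :> R by rewrite invr_gt0.
have := cgf_le_qvar bV inc s0 half0; rewrite hx mean_qvar//.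
move=> /(_ hx0); rewrite mulr_ge0 ?sqr_ge0// => /(_ isT).
set th := s ^+ 2 / _ => main.
have th0 : 0 <= th.
  apply: divr_ge0; first exact: sqr_ge0.
  by apply: mulr_ge0 (ltW hx0); rewrite mulr_ge0.
have thx : th * (2 * q ^+ 2) <= 8 / 3 * x * s.
  have -> : th * (2 * q ^+ 2) = x * s / (1 / 2 - x / 3).
    rewrite /th /x; field; rewrite gt_eqF//.
    by move: hx0; rewrite /x; clear; lra.
  rewrite ler_pdivrMr//.
  have : 0 <= x * s * (3 / 8 - x).
    by apply: mulr_ge0; [exact: mulr_ge0|rewrite subr_ge0].
  by clear; lra.
have : cgf (mu0 ^^ n) (qvar mu0 (qvar mu0 f)) th <=
    8 / 3 * x * cgf (mu0 ^^ n) (qvar mu0 f) s.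
  apply: le_trans (cgf_scale (mu0 ^^ n) s bV k01).
  rewrite -ler_expR !expR_cgf//; last by bmeas_tac.
  apply: (le_trans (mean_expR_qvar2 bf fi i0 th0)).
  apply: le_mean; [bmeas_tac..|move=> w].
  rewrite ler_expR ler_wpM2r ?qvar_ge0//.
  by apply: le_trans thx; rewrite ler_wpM2l.
move: main; move: (cgf _ (qvar mu0 f) s) (cgf _ _ th) (var _ f) => L W v.
by clear; lra.
Qed.

(** The exponent z = l * q balances the loss in Hoelder's inequality against
    the growth of the exponential moments of the quadratic variation. *)
Lemma cgf_bernstein n (f : n.-tuple T -> R) (b i q l : R) :
  bmeas f -> bdiff b f -> interaction i f -> 0 <= b -> 0 <= i ->
  b <= q -> n%:R * (n%:R - 1) / 2 * i ^+ 2 <= 2 * q ^+ 2 ->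
  n%:R * (i * b) <= 2 * q ^+ 2 ->
  0 < q -> 0 < l -> l * q <= 3 / 16 ->
  cgf (mu0 ^^ n) f l <= l * mean (mu0 ^^ n) f +
    l ^+ 2 * var (mu0 ^^ n) f / (2 * (1 - 8 / 3 * (l * q))).
Proof.
move=> bf fb fi b0 i0 bq hA hB q0 l0; set z := l * q => z316.
have z0 : 0 < z by rewrite mulr_gt0.
have hz0 : 0 < 1 - 4 / 3 * z by lra.
have hz8 : 0 < 1 - 8 / 3 * z by lra.
have hz38 : z <= 3 / 8 * (1 - 4 / 3 * z) by lra.
have inc := le_increments bq (bdiff_increments mu0 bf fb).
have hz : 1 - z - l * q / 3 = 1 - 4 / 3 * z by rewrite /z; field.
have := cgf_le_qvar bf inc (ltW l0) z0; rewrite hz => /(_ hz0 (ltW q0)).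
set s := l ^+ 2 / _ => main.
have s0 : 0 <= s.
  apply: divr_ge0; first exact: sqr_ge0.
  by apply: mulr_ge0 (ltW hz0); rewrite mulr_ge0// ltW.
have xE : 2 * q ^+ 2 * s = z / (1 - 4 / 3 * z).
  by rewrite /s /z; field; rewrite ?gt_eqF//; move: hz0; rewrite /z; clear; lra.
have x38 : 2 * q ^+ 2 * s <= 3 / 8 by rewrite xE ler_pdivrMr.
have := cgf_qvar bf fb fi b0 i0 hA hB s0 x38; rewrite xE => hV.
apply: (le_trans main); rewrite lerD2l.
rewrite ler_pdivlMr ?mulr_gt0//.
have -> : l ^+ 2 * var (mu0 ^^ n) f =
    z * (2 * (1 - 4 / 3 * z)) * (s * var (mu0 ^^ n) f).
  rewrite /s; field; rewrite ?gt_eqF//; move: hz0; clear; lra.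
have -> : 1 - 8 / 3 * z = (1 - 4 / 3 * z) * (1 - 4 / 3 * (z / (1 - 4 / 3 * z))).
  by field; rewrite gt_eqF//; move: hz0; clear; lra.
have w0 : 0 <= z * (2 * (1 - 4 / 3 * z)).
  by apply: mulr_ge0; [exact: ltW|apply: mulr_ge0 => //; exact: ltW].
apply: le_trans (ler_wpM2l w0 hV).
by rewrite le_eqVlt; apply/orP; left; apply/eqP; ring.
Qed.

End bernstein.

(** * Bernstein's inequality *)

Section tail.
Context {R : realType} d (T : measurableType d) (mu0 : probability T R).

Local Notation "mu0 ^^ n" := (power_probability mu0 n) (at level 30).

Lemma measurable_gt d' (Z : measurableType d') (f : Z -> R) (t : R) :
  measurable_fun [set: Z] f -> measurable [set x | t < f x].
Proof.
move=> mf; rewrite (_ : [set x | _] = [set: Z] `&` f @^-1` `]t, +oo[).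
  by apply: mf.
by apply/seteqP; split => x /=; rewrite in_itv/= andbT => //; case.
Qed.

Lemma chernoff_cgf d' (Z : measurableType d') (P : probability Z R)
    (f : Z -> R) (t l : R) : bmeas f -> 0 <= l ->
  (P [set x | (t < f x)%R] <= (expR (cgf P f l - l * t)%R)%:E)%E.
Proof.
move=> bf l0; have mA := measurable_gt t bf.1; set A := [set x | _] in mA *.
have b1 : bmeas (\1_A : Z -> R).
  split; first exact: measurable_indic.
  by exists 1 => x; rewrite indicE normr_nat lern1 leq_b1.
have -> : P A = (mean P (\1_A : Z -> R))%:E.
  by rewrite EFin_mean// integral_indic// setIT.
rewrite lee_fin expRB expR_cgf// mulrC -expRN -meanZ; last by bmeas_tac.
apply: le_mean; [by []|by bmeas_tac|move=> x].
rewrite -expRD indicE; have [xA|_] := boolP (x \in A); last exact: expR_ge0.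
apply: le_trans (expR_ge1Dx _); rewrite lerDl addrC -mulrBr mulr_ge0//.
by rewrite subr_ge0 ltW//; move: xA; rewrite inE.
Qed.

(** With c = 8 q / 3, the usual choice l = t / (v + c t) may leave the range of
    cgf_bernstein.  The choice l = t / (v + 2 c t) gives the same exponent and
    satisfies c * l <= 1 / 2, that is, l * q <= 3 / 16. *)
Lemma bernstein_upper n (f : n.-tuple T -> R) (b i q v t : R) :
  bmeas f -> bdiff b f -> interaction i f -> 0 <= b -> 0 <= i ->
  b <= q -> n%:R * (n%:R - 1) / 2 * i ^+ 2 <= 2 * q ^+ 2 ->
  n%:R * (i * b) <= 2 * q ^+ 2 -> 0 < q -> 0 < t ->
  var (mu0 ^^ n) f <= v ->
  (power_probability mu0 n [set x | (t + mean (mu0 ^^ n) f < f x)%R] <=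
   (expR (- t ^+ 2 / (2 * v + 16 / 3 * q * t))%R)%:E)%E.
Proof.
move=> bf fb fi b0 i0 bq hA hB q0 t0 fv.
have v0 : 0 <= v by exact: le_trans (var_ge0 _ _) fv.
have qt0 : 0 < q * t by rewrite mulr_gt0.
have D0 : 0 < v + 16 / 3 * (q * t) by lra.
pose l := t / (v + 16 / 3 * (q * t)).
have l0 : 0 < l by rewrite divr_gt0.
have lq : l * q <= 3 / 16 by rewrite /l mulrAC ler_pdivrMr//; lra.
apply: (le_trans (chernoff_cgf (mu0 ^^ n) _ bf (ltW l0))).
rewrite lee_fin ler_expR.
have cg := cgf_bernstein mu0 bf fb fi b0 i0 bq hA hB q0 l0 lq.
have h8 : 0 < 1 - 8 / 3 * (l * q) by lra.
have : l ^+ 2 * var (mu0 ^^ n) f / (2 * (1 - 8 / 3 * (l * q))) <=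
       l ^+ 2 * v / (2 * (1 - 8 / 3 * (l * q))).
  rewrite ler_pM2r ?invr_gt0 ?mulr_gt0//.
  by rewrite ler_wpM2l ?sqr_ge0.
suff : l ^+ 2 * v / (2 * (1 - 8 / 3 * (l * q))) - l * t =
    - t ^+ 2 / (2 * v + 16 / 3 * q * t) by lra.
have -> : 1 - 8 / 3 * (l * q) =
    (v + 8 / 3 * (q * t)) / (v + 16 / 3 * (q * t)).
  by rewrite /l; field; rewrite gt_eqF//; lra.
rewrite /l; field.
by rewrite !gt_eqF//; lra.
Qed.

Lemma bernstein n (f : n.-tuple T -> R) (b i q v t : R) :
  bmeas f -> bdiff b f -> interaction i f -> 0 <= b -> 0 <= i ->
  b <= q -> n%:R * (n%:R - 1) / 2 * i ^+ 2 <= 2 * q ^+ 2 ->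
  n%:R * (i * b) <= 2 * q ^+ 2 -> 0 < q -> 0 < t ->
  var (mu0 ^^ n) f <= v ->
  (power_probability mu0 n [set x | (t < `|f x - mean (mu0 ^^ n) f|)%R] <=
   (2 * expR (- t ^+ 2 / (2 * v + 16 / 3 * q * t)))%R%:E)%E.
Proof.
move=> bf fb fi b0 i0 bq hA hB q0 t0 fv.
pose m := mean (mu0 ^^ n) f; pose g x := -1 * f x.
have bg : bmeas g by rewrite /g; bmeas_tac.
have gb : bdiff b g by have := bdiffZ (-1) fb; rewrite normrN1 mul1r.
have gi : interaction i g.
  by have := interactionZ (-1) fi; rewrite normrN1 mul1r.
have gv : var (mu0 ^^ n) g <= v by rewrite varZ// sqrrN expr1n mul1r.
have up := bernstein_upper bf fb fi b0 i0 bq hA hB q0 t0 fv.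
have lo := bernstein_upper bg gb gi b0 i0 bq hA hB q0 t0 gv.
rewrite mulr_natl mulr2n EFinD.
have mup := measurable_gt (t + mean (mu0 ^^ n) f) bf.1.
have mlo := measurable_gt (t + mean (mu0 ^^ n) g) bg.1.
apply: le_trans (leeD up lo); apply: le_trans (measureU2 _ mup mlo).
apply: le_measure; rewrite ?inE.
- by apply: measurable_gt; apply: measurableT_comp => //;
    apply: measurable_funB; [exact: bf.1|exact: measurable_cst].
- exact: measurableU.
move=> x /=; rewrite /g meanZ// -/m lter_normr => /orP[h|h]; [left|right]; lra.
Qed.

End tail.

(** * The variance of a symmetric function *)

Section symmetric_variance.
Context {R : realType} d (T : measurableType d) (mu0 : probability T R).

Local Notation "mu0 ^^ n" := (power_probability mu0 n) (at level 30).

Definition swap_head n : (n.-tuple T -> R) -> Prop :=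
  match n with
  | k.+2 => fun f => forall y z s, slice (slice f y) z s = slice (slice f z) y s
  | _ => fun _ => True
  end.

(** Invariance under the transpositions of neighbouring arguments, in a form
    that is inherited by slices. *)
Fixpoint swap_sym n : (n.-tuple T -> R) -> Prop :=
  match n with
  | 0 => fun _ => True
  | k.+1 => fun f => swap_head f /\ forall y, swap_sym (slice f y)
  end.

(** The functional E is arbitrary: besides means, it may be a sum or a
    multiple. *)
Lemma swap_sym_mean n (Z : Type) (E : (Z -> R) -> R)
    (F : Z -> n.-tuple T -> R) :
  (forall z, swap_sym (F z)) -> swap_sym (fun s => E (fun z => F z s)).
Proof.
elim: n F => [//|n IHn] F Fs; split => [|y].
  case: n {IHn} F Fs => [//|n] F Fs y y' s.
  by congr E; apply/funext => z; exact: (Fs z).1.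
by apply: (IHn (fun z => slice (F z) y)) => z; exact: (Fs z).2.
Qed.

(** Both sides are the variance of F under the product measure, by the law of
    total variance. *)
Lemma var_swap d1 d2 (T1 : measurableType d1) (T2 : measurableType d2)
    (P1 : probability T1 R) (P2 : probability T2 R) (F : T1 * T2 -> R) :
  bmeas F ->
  mean P1 (fun y => var P2 (fun s => F (y, s))) +
    var P1 (fun y => mean P2 (fun s => F (y, s))) =
  mean P2 (fun s => var P1 (fun y => F (y, s))) +
    var P2 (fun s => mean P1 (fun y => F (y, s))).
Proof.
move=> bF; have bF2 : bmeas (fun z => F z ^+ 2) by bmeas_tac.
have bFs : bmeas (fun z : T2 * T1 => F (z.2, z.1)).
  by apply: (bmeas_comp (h := fun z : T2 * T1 => (z.2, z.1))) => //;
    exact: measurable_swap.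
have bF2s : bmeas (fun z : T2 * T1 => F (z.2, z.1) ^+ 2) by bmeas_tac.
under eq_mean => y do rewrite (varE _ (bmeas_slicel y bF)).
under [in RHS]eq_mean => s do rewrite (varE _ (bmeas_slicer s bF)).
have b1 := bmeas_mean P2 bF; have b2 := bmeas_mean P2 bF2.
have b3 := bmeas_mean P1 bFs; have b4 := bmeas_mean P1 bF2s.
rewrite !meanB; [|by []|exact: bmeasX|by []|exact: bmeasX].
rewrite (varE P1 b1) (varE P2 b3) !subrKA.
by rewrite (mean_swap _ _ bF2) (mean_swap _ _ bF).
Qed.

(** Averaging f over its first argument loses at most the variance of the
    interaction: var_swap shows that the loss does not change when the part c
    that does not depend on this argument is subtracted. *)
Lemma mean_var_slice n (f : n.+1.-tuple T -> R) (c : n.-tuple T -> R) (i : R) :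
  bmeas f -> bmeas c -> (forall y, bdiff i (fun s => slice f y s - c s)) ->
  mean mu0 (fun y => var (mu0 ^^ n) (slice f y)) <=
  var (mu0 ^^ n) (fun s => mean mu0 (fun y => slice f y s)) +
    n%:R * (i ^+ 2 / 4).
Proof.
have arith (a a' v e w w' k : R) : a' + v = e + w' -> a + v = e + w ->
    a' <= k -> 0 <= w' -> a <= w + k by lra.
move=> bf bc fc.
have bF := bmeas_slice2 bf.
have bc2 : bmeas (fun z : T * n.-tuple T => c z.2).
  by apply: bmeas_comp bc; exact: measurable_snd.
have bU := bmeasB bF bc2.
have EF := var_swap mu0 (mu0 ^^ n) bF; have EU := var_swap mu0 (mu0 ^^ n) bU.
rewrite /= in EF EU.
have hc : mean (mu0 ^^ n) (fun s => var mu0 (fun y => slice f y s - c s)) =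
    mean (mu0 ^^ n) (fun s => var mu0 (fun y => slice f y s)).
  apply: eq_mean => s; rewrite -(var_shift mu0 (- c s) (bmeas_slicer s bF)).
  by congr var; apply/funext => y; rewrite addrC.
have hm : var mu0 (fun y => mean (mu0 ^^ n) (fun s => slice f y s - c s)) =
    var mu0 (fun y => mean (mu0 ^^ n) (fun s => slice f y s)).
  rewrite (_ : (fun y => mean (mu0 ^^ n) (fun s => slice f y s - c s)) =
      fun y => - mean (mu0 ^^ n) c + mean (mu0 ^^ n) (slice f y)).
    by apply: var_shift; exact: bmeas_mean_slice.
  apply/funext => y; rewrite meanB; [exact: addrC|by bmeas_tac|exact: bc].
have hU : mean mu0 (fun y => var (mu0 ^^ n) (fun s => slice f y s - c s)) <=
    n%:R * (i ^+ 2 / 4).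
  pose U x := f x - c (behead_tuple x).
  have sU y : slice U y = fun s => slice f y s - c s.
    by apply/funext => s; rewrite /slice /U behead_cons_tuple.
  have bcb : bmeas (fun x : n.+1.-tuple T => c (behead_tuple x)).
    by apply: bmeas_comp bc; exact: measurable_behead.
  have bU' : bmeas U := bmeasB bf bcb.
  rewrite -(eq_mean mu0 (f := fun y => var (mu0 ^^ n) (slice U y))) => [|y].
    apply: mean_le => [|y]; first exact: bmeas_var_slice.
    apply: var_bdiff; first exact: bmeas_slice.
    by rewrite sU; exact: fc.
  by rewrite sU.
have h0 := var_ge0 (mu0 ^^ n) (fun s => mean mu0 (fun y => slice f y s - c s)).
rewrite hc hm in EU.
exact: (arith _ _ _ _ _ _ _ EU EF hU h0).
Qed.

(** By symmetry, averaging f over its first argument gives a symmetric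
    function whose own first-order projection is again that of f. *)
Lemma var_symmetric n (f : n.+1.-tuple T -> R) (c : n.-tuple T -> R) (i : R) :
  bmeas f -> swap_sym f -> bmeas c ->
  (forall y, bdiff i (fun s => slice f y s - c s)) ->
  var (mu0 ^^ n.+1) f <=
  n.+1%:R * var mu0 (fun y => mean (mu0 ^^ n) (slice f y)) +
    n.+1%:R * n%:R / 2 * (i ^+ 2 / 4).
Proof.
have arith (N A B C k : R) : B <= C + N * k ->
    C <= N * A + N * (N - 1) / 2 * k ->
    A + B <= (N + 1) * A + (N + 1) * N / 2 * k by lra.
have bsw k (h : k.+1.-tuple T -> R) : bmeas h ->
    bmeas (fun s => mean mu0 (fun y => slice h y s)).
  move=> bh; apply: (bmeas_mean mu0
    (F := fun z : k.-tuple T * T => slice h z.2 z.1)).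
  apply: (bmeas_comp (h := fun z : k.-tuple T * T => (z.2, z.1)) _
    (bmeas_slice2 bh)).
  exact: measurable_swap.
elim: n f c => [|n IHn] f c bf fs bc fc.
  rewrite varSE// mul1r lerD2l mulr0 mul0r mul0r.
  have := mean_var_slice bf bc fc; rewrite mul0r addr0 => /le_trans; apply.
  by have := var_bdiff mu0 (b := 0) (bsw _ _ bf) Logic.I; rewrite mul0r.
pose g s := mean mu0 (fun y => slice f y s).
pose e s := mean mu0 (fun y => slice c y s).
have bg : bmeas g by exact: bsw bf.
have be : bmeas e by exact: bsw bc.
have [sw fs2] := fs.
have gs : swap_sym g by exact: (swap_sym_mean (mean mu0)).
have gE y : slice g y = fun s => mean mu0 (fun z => slice (slice f y) z s).
  by apply/funext => s; apply: eq_mean => z; exact: sw.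
have ge y : bdiff i (fun s => slice g y s - e s).
  rewrite (_ : (fun s => _) = fun s => mean mu0 (fun z =>
      slice (slice f y) z s - slice c z s)).
    apply: (bdiff_mean mu0 (F := fun w : T * n.-tuple T =>
      slice (slice f y) w.1 w.2 - slice c w.1 w.2)) => [|z].
      by apply: bmeasB; apply: bmeas_slice2; bmeas_tac.
    exact: (fc y).2.
  apply/funext => s; rewrite gE /e meanB//.
    exact: (bmeas_slicer s (bmeas_slice2 (bmeas_slice y bf))).
  exact: (bmeas_slicer s (bmeas_slice2 bc)).
have hE : (fun y => mean (mu0 ^^ n) (slice g y)) =
    fun y => mean (mu0 ^^ n.+1) (slice f y).
  apply/funext => y; rewrite gE [RHS]meanSE; last by bmeas_tac.
  exact: (esym (mean_swap mu0 (mu0 ^^ n) (bmeas_slice2 (bmeas_slice y bf)))).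
have := IHn g e bg gs be ge; rewrite hE => hg.
have hf := mean_var_slice bf bc fc.
rewrite varSE// -[n.+2%:R]natr1.
by apply: arith hf _; rewrite -[n.+1%:R]natr1 addrK natr1.
Qed.

End symmetric_variance.

(** * U-statistics *)

Section u_statistic.
Context {R : realType} d (T : measurableType d).

Definition usum m n (g : m.-tuple T -> R) (x : n.-tuple T) : R :=
  \sum_(j : m.-tuple 'I_n | sorted ltn (map val j)) g [tuple of map (tnth x) j].

Lemma usum0 n (g : 0.-tuple T -> R) (x : n.-tuple T) : usum g x = g [tuple].
Proof.
rewrite /usum (big_pred1 [tuple]) => [|j]; first by congr g; apply: val_inj.
by rewrite tuple0 /= eqxx.
Qed.

Lemma usum_nil m (g : m.+1.-tuple T -> R) (x : 0.-tuple T) : usum g x = 0.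
Proof. by rewrite /usum big1// => j _; case: (thead j). Qed.

Definition shift n m (j : m.-tuple 'I_n) : m.-tuple 'I_n.+1 :=
  [tuple of map (lift ord0) j].

Lemma shift_inj n m : injective (@shift n m).
Proof.
by move=> j k /(congr1 val) /inj_map - /(_ (@lift_inj _ _)) /val_inj.
Qed.

Lemma cons_shift_inj n m : injective (fun j => cons_tuple ord0 (@shift n m j)).
Proof.
move=> j k /(congr1 (fun z : m.+1.-tuple 'I_n.+1 => behead z)).
by move=> /val_inj/shift_inj.
Qed.

Lemma shift_surj n m (j : m.-tuple 'I_n.+1) :
  all (ltn 0) (map val j) -> exists k, shift k = j.
Proof.
rewrite all_map => /all_tnthP j0.
have e k : {l | tnth j k = lift ord0 l}.
  case: (unliftP ord0 (tnth j k)) => [l ->|jk]; first by exists l.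
  by have := j0 k; rewrite /= jk.
exists [tuple sval (e k) | k < m]; apply: eq_from_tnth => k.
by rewrite tnth_map tnth_mktuple -(svalP (e k)).
Qed.

Lemma all_shift n m (j : m.-tuple 'I_n) : all (ltn 0) (map val (shift j)).
Proof. by rewrite -map_comp all_map; apply/allP => k _ /=. Qed.

Lemma sorted_shift n m (j : m.-tuple 'I_n) :
  sorted ltn (map val (shift j)) = sorted ltn (map val j).
Proof.
rewrite /= -map_comp (eq_map (g := S \o (@nat_of_ord n))) => [|k].
  by rewrite map_comp sorted_map; apply: eq_sorted => a b.
exact: lift0.
Qed.

Lemma tnth_shift n m (j : m.-tuple 'I_n) y (s : n.-tuple T) :
  map (tnth (cons_tuple y s)) (shift j) = map (tnth s) j.
Proof. by rewrite -map_comp; apply: eq_map => k /=; rewrite tnthS. Qed.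

(** Pascal's recursion: a set of indices either avoids the first index or
    contains it. *)
Lemma slice_usum m n (g : m.+1.-tuple T -> R) y :
  slice (usum (n := n.+1) g) y = fun s => usum g s + usum (slice g y) s.
Proof.
apply/funext => s; rewrite /slice /usum.
rewrite (bigID (fun j : m.+1.-tuple 'I_n.+1 => thead j == ord0)) /= addrC.
congr (_ + _).
  rewrite (reindex_omap (@shift n m.+1) (fun j => [pick k | shift k == j])).
    apply: eq_big => [j|j _].
      rewrite sorted_shift; case: pickP => [k /eqP/shift_inj ->|/(_ j)].
        rewrite eqxx andbT; case: sorted => //=.
        by case/tupleP: j => a j.
      by rewrite eqxx.
    by congr g; apply: val_inj; rewrite /= tnth_shift.
  move=> j /andP[sj j0]; case: pickP => [k /eqP <-//|nok].
  have [|k kj] := @shift_surj n m.+1 j; last by have := nok k; rewrite kj eqxx.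
  case/tupleP: j sj j0 {nok} => a j /=.
  rewrite theadE -val_eqE /= -lt0n => sj a0.
  rewrite a0 /=; move: sj; rewrite path_sortedE; last exact: ltn_trans.
  by case/andP => /allP aj _; apply/allP => b /aj; exact: ltn_trans.
rewrite (reindex_omap (fun k => cons_tuple ord0 (@shift n m k))
  (fun j => [pick k | cons_tuple ord0 (shift k) == j])).
  apply: eq_big => [j|j _].
    rewrite theadE eqxx andbT /= path_sortedE; last exact: ltn_trans.
    rewrite (all_shift j) sorted_shift /=.
    case: pickP => [k /eqP/cons_shift_inj ->|/(_ j)].
      by rewrite eqxx andbT.
    by rewrite eqxx.
  by congr g; apply: val_inj; rewrite /= -(tnth_shift j y s).
move=> j /andP[sj j0]; case: pickP => [k /eqP <-//|nok].
case/tupleP: j sj j0 nok => a j /= sj; rewrite theadE => /eqP a0 nok.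
rewrite a0 /= path_sortedE in sj nok; last exact: ltn_trans.
case/andP: sj => jgt0 _; have [k kj] := shift_surj jgt0.
by have := nok k; rewrite kj eqxx.
Qed.

Lemma bmeas_usum m n (g : m.-tuple T -> R) :
  bmeas g -> bmeas (usum (n := n) g).
Proof.
move=> bg; rewrite /usum.
have bj (j : m.-tuple 'I_n) :
    bmeas (fun x : n.-tuple T => g [tuple of map (tnth x) j]).
  apply: (bmeas_comp _ bg); apply/measurable_fun_tnthP => k.
  rewrite (_ : _ \o _ = fun x => tnth x (tnth j k)).
    exact: measurable_tnth.
  by apply/funext => x; rewrite /= tnth_map.
elim: (index_enum _) => [|j r IHr].
  rewrite (_ : (fun x => _) = fun=> 0); first exact: bmeas_cst.
  by apply/funext => x; rewrite big_nil.
case: (boolP (sorted ltn (map val j))) => jP.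
  rewrite (_ : (fun x => _) = fun x => g [tuple of map (tnth x) j] +
    \sum_(j <- r | sorted ltn (map val j)) g [tuple of map (tnth x) j]).
    exact: bmeasD.
  by apply/funext => x; rewrite big_cons jP.
rewrite (_ : (fun x => _) = fun x =>
  \sum_(j <- r | sorted ltn (map val j)) g [tuple of map (tnth x) j]) //.
by apply/funext => x; rewrite big_cons (negbTE jP).
Qed.

End u_statistic.

(** * Sensitivity of U-statistics *)

Section u_statistic_sensitivity.
Context {R : realType} d (T : measurableType d) (mu0 : probability T R).

Local Notation "mu0 ^^ n" := (power_probability mu0 n) (at level 30).

Lemma bdiff_cst n (c : R) : bdiff 0 (fun _ : n.-tuple T => c).
Proof.
elim: n => [//|n IHn]; split => [y y' s|y]; last exact: IHn.
by rewrite /slice subrr normr0.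
Qed.

Lemma usum0E n (g : 0.-tuple T -> R) :
  usum (n := n) g = fun=> g [tuple].
Proof. by apply/funext => x; exact: usum0. Qed.

Lemma normr_usum m n (g : m.-tuple T -> R) (K : R) x :
  (forall z, `|g z| <= K) -> `|usum (n := n) g x| <= 'C(n, m)%:R * K.
Proof.
elim: n m g x => [|n IHn] [|m] g x gK.
- by rewrite usum0 mul1r.
- by rewrite usum_nil normr0 mul0r.
- by rewrite usum0 mul1r.
rewrite slice_eta slice_usum binS natrD mulrDl.
apply: (le_trans (ler_normD _ _)); apply: lerD; apply: IHn => // z.
exact: gK.
Qed.

Lemma mean_usum m n (g : m.-tuple T -> R) : bmeas g ->
  mean (mu0 ^^ n) (usum g) = 'C(n, m)%:R * mean (mu0 ^^ m) g.
Proof.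
elim: n m g => [|n IHn] [|m] g bg.
- by rewrite usum0E mean_cst mean0E// mul1r.
- rewrite (_ : usum g = fun=> 0) ?mean_cst ?mul0r//.
  by apply/funext => x; exact: usum_nil.
- by rewrite usum0E mean_cst mean0E// mul1r.
rewrite meanSE; last exact: bmeas_usum.
rewrite (eq_mean mu0 (g := fun y => mean (mu0 ^^ n) (usum g) +
  'C(n, m)%:R * mean (mu0 ^^ m) (slice g y))).
  rewrite meanD; [|exact: bmeas_cst|by bmeas_tac].
  rewrite mean_cst meanZ; last by bmeas_tac.
  by rewrite -meanSE// IHn// binS natrD mulrDl.
move=> y; rewrite slice_usum meanD; last 2 first.
- exact: bmeas_usum.
- by apply: bmeas_usum; bmeas_tac.
by rewrite (IHn m)//; bmeas_tac.
Qed.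

(** A change of one argument affects only the terms whose set of indices
    contains its index, and each of them by at most 2. *)
Lemma bdiff_usum m n (g : m.+1.-tuple T -> R) : (forall z, `|g z| <= 1) ->
  bdiff (2 * 'C(n, m)%:R) (usum (n := n.+1) g).
Proof.
have first_diff k j (h : j.+1.-tuple T -> R) y y' (s : k.-tuple T) :
    (forall z, `|h z| <= 1) ->
    `|slice (usum h) y s - slice (usum h) y' s| <= 2 * 'C(k, j)%:R.
  move=> h1; rewrite !slice_usum opprD addrACA subrr add0r.
  apply: (le_trans (ler_normB _ _)); rewrite mulr_natl mulr2n.
  by apply: lerD; rewrite -[leRHS]mulr1; apply: normr_usum => z; exact: h1.
elim: n m g => [|n IHn] m g g1; split => [y y' s|y]; try exact: first_diff.
  by [].
rewrite slice_usum; case: m g g1 => [|m] g g1.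
  rewrite usum0E -[X in bdiff X](addr0) !bin0.
  apply: bdiffD; last exact: bdiff_cst.
  by have := IHn 0%N g g1; rewrite bin0.
rewrite binS natrD mulrDr; apply: bdiffD; first exact: IHn.
by apply: IHn => z; exact: g1.
Qed.

Lemma slice_usumB m n (g : m.+1.-tuple T -> R) y :
  (fun s => slice (usum (n := n.+1) g) y s - usum g s) = usum (slice g y).
Proof. by apply/funext => s; rewrite slice_usum addrAC subrr add0r. Qed.

Lemma interaction_cst n (c : R) : interaction 0 (fun _ : n.-tuple T => c).
Proof.
elim: n => [//|n IHn]; split => [|y]; last exact: IHn.
exists (fun=> 0); split => [|y]; first exact: bmeas_cst.
exact: (bdiff_cst n (c - 0)).
Qed.

Lemma interaction_usum1 n (g : 1.-tuple T -> R) : bmeas g ->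
  interaction 0 (usum (n := n) g).
Proof.
move=> bg; elim: n => [//|n IHn]; split => [|y].
  exists (usum g); split => [|y]; first exact: bmeas_usum.
  by rewrite slice_usumB usum0E; exact: bdiff_cst.
rewrite slice_usum usum0E -[X in interaction X](addr0).
by apply: interactionD => //; exact: interaction_cst.
Qed.

(** Two arguments interact only in the terms whose set of indices contains both
    indices. *)
Lemma interaction_usum m n (g : m.+2.-tuple T -> R) : bmeas g ->
  (forall z, `|g z| <= 1) ->
  interaction (2 * 'C(n, m)%:R) (usum (n := n.+2) g).
Proof.
have first_part k j (h : j.+2.-tuple T -> R) : bmeas h ->
    (forall z, `|h z| <= 1) ->
    exists c, bmeas c /\
      forall y, bdiff (2 * 'C(k, j)%:R)
        (fun s => slice (usum (n := k.+2) h) y s - c s).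
  move=> bh h1; exists (usum h); split => [|y]; first exact: bmeas_usum.
  by rewrite slice_usumB; apply: bdiff_usum => z; exact: h1.
elim: n m g => [|n IHn] m g bg g1; split; try exact: first_part.
  move=> y; split => //; exists (fun=> 0); split => [|//].
  exact: bmeas_cst.
move=> y; rewrite slice_usum; case: m g bg g1 => [|m] g bg g1.
  rewrite -[X in interaction X](addr0) !bin0.
  apply: interactionD; last by apply: interaction_usum1; bmeas_tac.
  by have := IHn 0%N g bg g1; rewrite bin0.
rewrite binS natrD mulrDr; apply: interactionD; first exact: IHn.
by apply: IHn => [|z]; [bmeas_tac|exact: g1].
Qed.

Lemma swap_symD n (f g : n.-tuple T -> R) : swap_sym f -> swap_sym g ->
  swap_sym (fun x => f x + g x).
Proof.
move=> fs gs; apply: (@swap_sym_mean R _ T n bool (fun h => h true + h false)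
  (fun b => if b then f else g)).
by case.
Qed.

Lemma swap_symZ n (f : n.-tuple T -> R) (c : R) : swap_sym f ->
  swap_sym (fun x => c * f x).
Proof.
move=> fs.
by apply: (@swap_sym_mean R _ T n unit (fun h => c * h tt) (fun=> f)).
Qed.

Lemma swap_sym_cst n (c : R) : swap_sym (fun _ : n.-tuple T => c).
Proof. by elim: n => [//|n IHn]; split => //; case: n {IHn}. Qed.

Lemma swap_sym_usum m n (g : m.-tuple T -> R) : swap_sym g ->
  swap_sym (usum (n := n) g).
Proof.
elim: n m g => [//|n IHn] [|m] g gs.
  by rewrite usum0E; exact: swap_sym_cst.
split => [|y]; last first.
  by rewrite slice_usum; apply: swap_symD; apply: IHn => //; exact: gs.2.
case: n IHn => [//|n] IHn y z s.
have slice2 a b : slice (slice (usum g) a) b s =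
    usum g s + usum (slice g b) s + slice (usum (slice g a)) b s.
  by rewrite slice_usum /slice -/(slice (usum g) b s) slice_usum.
rewrite !slice2; case: m g gs slice2 => [|m] g gs _.
  by rewrite !usum0 !usum0E addrAC.
have gsw : slice (slice g y) z = slice (slice g z) y.
  by apply/funext => w; exact: gs.1.
by rewrite !slice_usum !addrA gsw; congr (_ + _); rewrite addrAC.
Qed.

Lemma symmetric_swap_sym n (f : n.-tuple T -> R) :
  symmetric_fun f -> swap_sym f.
Proof.
move=> fs; have {fs} : forall x x' : n.-tuple T, perm_eq x x' -> f x = f x'.
  move=> x x' /tuple_permP[s xs]; rewrite -(fs s x').
  by congr f; apply: val_inj.
elim: n f => [//|n IHn] f fs; split => [|y]; last first.
  by apply: IHn => x x' xx'; apply: fs; rewrite perm_cons.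
case: n {IHn} f fs => [//|n] f fs y z s.
by apply: fs; apply/permPl; exact: (perm_catCA [:: y] [:: z] s).
Qed.

End u_statistic_sensitivity.

(** * Variance and constants of U-statistics *)

Section expectation_mean.
Context {R : realType} d (T : measurableType d) (P : probability T R).

Lemma fine_expectation (f : T -> R) : fine ('E_P[f])%E = mean P f.
Proof. by rewrite unlock. Qed.

Lemma fine_variance (f : T -> R) : fine ('V_P[f])%E = var P f.
Proof.
rewrite /variance covariance.unlock fine_expectation fine_expectation /var.
by apply: eq_mean => x.
Qed.

End expectation_mean.

Section main.
Context {R : realType} d (T : measurableType d) (mu0 : probability T R).

Local Notation "mu0 ^^ n" := (power_probability mu0 n) (at level 30).

Lemma fine_var_partial_mean m (g : m.+1.-tuple T -> R) :
  fine ('V_mu0[partial_mean mu0 g])%E =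
  var mu0 (fun y => mean (mu0 ^^ m) (slice g y)).
Proof.
rewrite fine_variance; congr var; apply/funext => y.
rewrite /partial_mean fine_expectation; apply: eq_mean => s.
by congr g; apply: val_inj; rewrite /= cons_predE.
Qed.

(** These are the fractions of the m-subsets of n indices that contain a given
    index, respectively two given indices, for m.+2 and n.+2 in the place of m
    and n. *)
Lemma binomial_fractions n m : (m <= n)%N ->
  'C(n.+1, m.+1)%:R / 'C(n.+2, m.+2)%:R = m.+2%:R / n.+2%:R :> R /\
  'C(n, m)%:R / 'C(n.+2, m.+2)%:R =
    m.+2%:R * m.+1%:R / (n.+2%:R * n.+1%:R) :> R.
Proof.
move=> mn; have e1 := mul_bin_diag n.+2 m.+1; have e2 := mul_bin_diag n.+1 m.
move: e1 e2 => /= /(congr1 (fun k => k%:R : R)) + /(congr1 (fun k => k%:R : R)).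
rewrite !natrM => e1 e2.
have C0 : 'C(n.+2, m.+2)%:R != 0 :> R by rewrite pnatr_eq0 -lt0n bin_gt0.
have N2 : n.+2%:R != 0 :> R by rewrite pnatr_eq0.
have N1 : n.+1%:R != 0 :> R by rewrite pnatr_eq0.
split; first by apply/eqP; rewrite eqr_div// -e1 mulrC.
apply/eqP; rewrite eqr_div ?mulf_neq0//.
rewrite [X in X == _](_ : _ = n.+2%:R * (n.+1%:R * 'C(n, m)%:R)); last by ring.
by rewrite e2 mulrCA e1; apply/eqP; ring.
Qed.

(** A given argument occurs in a fraction m / n of the terms, so that the
    first-order projection of the statistic is this multiple of that of g, up
    to a constant. *)
Lemma var_u_statistic n m (g : m.+2.-tuple T -> R) :
  bmeas g -> (forall z, `|g z| <= 1) -> symmetric_fun g -> (m < n)%N ->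
  var (mu0 ^^ n.+2) (fun x => 'C(n.+2, m.+2)%:R^-1 * usum g x) <=
  m.+2%:R ^+ 2 / n.+2%:R * var mu0 (fun y => mean (mu0 ^^ m.+1) (slice g y)) +
    m.+2%:R ^+ 2 * (m.+2%:R - 1) ^+ 2 / (2 * n.+2%:R * (n.+2%:R - 1)).
Proof.
set M := m.+2%:R; set N := n.+2%:R => bg g1 gs mn.
set K := 'C(n.+2, m.+2)%:R^-1.
have K0 : 0 <= K by rewrite invr_ge0.
have [f1 f2] := binomial_fractions (ltnW mn).
have bu : bmeas (fun x : n.+2.-tuple T => K * usum g x).
  by apply: bmeasM; [exact: bmeas_cst|exact: bmeas_usum].
have sg : swap_sym (usum (n := n.+2) g).
  by apply: swap_sym_usum; exact: symmetric_swap_sym.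
have bc : bmeas (fun s : n.+1.-tuple T => K * usum g s).
  by apply: bmeasM; [exact: bmeas_cst|exact: bmeas_usum].
have := var_symmetric mu0 (i := K * (2 * 'C(n, m)%:R)) bu
  (swap_symZ K sg) bc.
have cd y : bdiff (K * (2 * 'C(n, m)%:R)) (fun s =>
    slice (fun x => K * usum (n := n.+2) g x) y s - K * usum g s).
  rewrite (_ : (fun s => _) = fun s => K * usum (slice g y) s).
    rewrite -{1}(ger0_norm K0); apply: bdiffZ; apply: bdiff_usum => z.
    exact: g1.
  by apply/funext => s; rewrite -slice_usumB mulrBr.
move=> /(_ cd) /le_trans; apply.
have -> : (fun y => mean (mu0 ^^ n.+1)
    (slice (fun x => K * usum (n := n.+2) g x) y)) =
    fun y => K * mean (mu0 ^^ n.+1) (usum g) +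
      K * 'C(n.+1, m.+1)%:R * mean (mu0 ^^ m.+1) (slice g y).
  apply/funext => y.
  rewrite (_ : slice _ y = fun s => K * slice (usum g) y s)//.
  rewrite slice_usum meanZ; last first.
    by apply: bmeasD; apply: bmeas_usum; bmeas_tac.
  rewrite meanD; last 2 first.
  - exact: bmeas_usum.
  - by apply: bmeas_usum; bmeas_tac.
  by rewrite mulrDr [X in _ + K * X]mean_usum ?mulrA//; bmeas_tac.
rewrite var_shift; last by bmeas_tac.
rewrite varZ; last by bmeas_tac.
rewrite (mulrC K) f1 -/M -/N (_ : K * _ = 2 * (M * m.+1%:R / (N * n.+1%:R))).
  have -> : m.+1%:R = M - 1 :> R by rewrite /M -[m.+2%:R]natr1 addrK.
  have -> : n.+1%:R = N - 1 :> R by rewrite /N -[n.+2%:R]natr1 addrK.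
  set V := var mu0 _; clearbody V.
  have N1 : 1 < N by rewrite ltr1n.
  rewrite le_eqVlt; apply/orP; left; apply/eqP.
  by field; rewrite !gt_eqF//; lra.
by rewrite -f2 mulrCA (mulrC K).
Qed.

End main.

(** These are the hypotheses of bernstein for a U-statistic, with q = M^2 / N,
    differences 2 M / N and interaction 2 M (M - 1) / (N (N - 1)).  They follow
    from (M - 1) / (N - 1) <= M / N and 2 <= M. *)
Lemma u_statistic_constants (R : realFieldType) (M N : R) :
  2 <= M -> M + 1 <= N ->
  [/\ 2 * (M / N) <= M ^+ 2 / N,
      N * (N - 1) / 2 * (2 * (M * (M - 1) / (N * (N - 1)))) ^+ 2 <=
        2 * (M ^+ 2 / N) ^+ 2 &
      N * (2 * (M * (M - 1) / (N * (N - 1))) * (2 * (M / N))) <=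
        2 * (M ^+ 2 / N) ^+ 2].
Proof.
move=> M2 MN; have N0 : 0 < N by lra.
have N1 : 0 < N - 1 by lra.
have MM : 0 <= (M - 2) * M by rewrite mulr_ge0//; lra.
have NM : 0 <= (N - (M + 1)) * M by rewrite mulr_ge0//; lra.
have MN2 : 0 <= (M - 2) * N by rewrite mulr_ge0//; lra.
have NMM : 0 <= (N - (M + 1)) * (M ^+ 2 - 2 * M + 2).
  by rewrite mulr_ge0//; lra.
have MMM : 0 <= (M - 2) * M ^+ 2 by rewrite mulr_ge0 ?sqr_ge0//; lra.
have w0 : 0 <= 2 * M ^+ 2 / (N ^+ 2 * (N - 1)).
  apply: divr_ge0; first by rewrite mulr_ge0// sqr_ge0.
  by rewrite mulr_ge0 ?sqr_ge0// ltW.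
split.
- by rewrite mulrA ler_pM2r ?invr_gt0//; lra.
- rewrite -subr_ge0 [leRHS](_ : _ = 2 * M ^+ 2 / (N ^+ 2 * (N - 1)) *
    (M ^+ 2 * (N - 1) - (M - 1) ^+ 2 * N)); last first.
    by field; rewrite !gt_eqF.
  by apply: mulr_ge0 => //; lra.
rewrite -subr_ge0 [leRHS](_ : _ = 2 * M ^+ 2 / (N ^+ 2 * (N - 1)) *
    (M ^+ 2 * (N - 1) - 2 * (M - 1) * N)); last first.
  by field; rewrite !gt_eqF.
by apply: mulr_ge0 => //; lra.
Qed.

Theorem theorem6 (R : realType) (d : measure_display) (X : measurableType d)
    (mu0 : probability X R) (m n : nat) (g : m.-tuple X -> R)
    (hm : (1 < m)%N) (hmn : (m < n)%N)
    (mg : measurable_fun [set: m.-tuple X] g)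
    (g_bounded : forall x, -1 <= g x <= 1)
    (g_sym : symmetric_fun g) (t : R) (t_gt0 : 0 < t) :
  let mu := power_probability mu0 n in
  let u := fun x : n.-tuple X => U_statistic g x in
  (mu [set x | (t < `|u x - fine 'E_mu[u]|)%R] <=
   (2 * expR (- n%:R * t ^+ 2 /
     (2 * m%:R ^+ 2 * fine 'V_mu0[partial_mean mu0 g]
      + m%:R ^+ 2 * (m%:R - 1) ^+ 2 / (n%:R - m%:R)
      + 16 * m%:R ^+ 2 * t / 3)))%R%:E)%E.
Proof.
have g1 z : `|g z| <= 1 by rewrite ler_norml.
have bg : bmeas g by split => //; exists 1.
case: m n hm hmn g mg g_bounded g_sym g1 bg =>
  [|[|m]]// [|[|n]]// _ mn g _ _ gs g1 bg.
cbv zeta; rewrite fine_expectation fine_var_partial_mean.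
set S := var mu0 _; set M := m.+2%:R; set N := n.+2%:R.
have M2 : 2 <= M by rewrite ler_nat.
have MN : M + 1 <= N by rewrite natr1 ler_nat.
have S0 : 0 <= S by exact: var_ge0.
have [f1 f2] := @binomial_fractions R n m (ltnW mn).
have [q1 q2 q3] := u_statistic_constants M2 MN.
have mM : m.+1%:R = M - 1 :> R by rewrite /M -[m.+2%:R]natr1 addrK.
have nN : n.+1%:R = N - 1 :> R by rewrite /N -[n.+2%:R]natr1 addrK.
rewrite mM nN -/M -/N in f1 f2.
set K := 'C(n.+2, m.+2)%:R in f1 f2.
have K0 : 0 <= K^-1 by rewrite invr_ge0.
have bu : bmeas (fun x : n.+2.-tuple X => K^-1 * usum g x).
  by apply: bmeasM; [exact: bmeas_cst|exact: bmeas_usum].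
have bd : bdiff (2 * (M / N)) (fun x : n.+2.-tuple X => K^-1 * usum g x).
  have -> : 2 * (M / N) = `|K^-1| * (2 * 'C(n.+1, m.+1)%:R).
    by rewrite ger0_norm// -f1; ring.
  by apply: bdiffZ; exact: bdiff_usum.
have int : interaction (2 * (M * (M - 1) / (N * (N - 1))))
    (fun x : n.+2.-tuple X => K^-1 * usum g x).
  have -> : 2 * (M * (M - 1) / (N * (N - 1))) = `|K^-1| * (2 * 'C(n, m)%:R).
    by rewrite ger0_norm// -f2; ring.
  by apply: interactionZ; exact: interaction_usum.
have vu := var_u_statistic mu0 bg g1 gs mn.
rewrite -/K -/M -/N -/S in vu.
pose v := (2 * M ^+ 2 * S + M ^+ 2 * (M - 1) ^+ 2 / (N - M)) / (2 * N).
have uv : var (power_probability mu0 n.+2)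
    (fun x : n.+2.-tuple X => K^-1 * usum g x) <= v.
  apply: (le_trans vu).
  have -> : v = M ^+ 2 / N * S + M ^+ 2 * (M - 1) ^+ 2 / (2 * N * (N - M)).
    by rewrite /v; clearbody S M N; field; rewrite !gt_eqF//; lra.
  rewrite lerD2l; apply: ler_wpM2l; first by rewrite mulr_ge0 ?sqr_ge0.
  have N0 : 0 < 2 * N by lra.
  by rewrite lef_pV2 ?posrE ?ler_pM2l ?pmulr_rgt0//; lra.
have b0 : 0 <= 2 * (M / N) by rewrite mulr_ge0// divr_ge0//; lra.
have i0 : 0 <= 2 * (M * (M - 1) / (N * (N - 1))).
  by rewrite mulr_ge0// divr_ge0// mulr_ge0//; lra.
have q0 : 0 < M ^+ 2 / N by rewrite divr_gt0// ?exprn_gt0//; lra.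
have := bernstein bu bd int b0 i0 q1 q2 q3 q0 t_gt0 uv.
have -> : - t ^+ 2 / (2 * v + 16 / 3 * (M ^+ 2 / N) * t) =
  - N * t ^+ 2 / (2 * M ^+ 2 * S + M ^+ 2 * (M - 1) ^+ 2 / (N - M) +
    16 * M ^+ 2 * t / 3).
  have -> : 2 * M ^+ 2 * S + M ^+ 2 * (M - 1) ^+ 2 / (N - M) +
      16 * M ^+ 2 * t / 3 = N * (2 * v + 16 / 3 * (M ^+ 2 / N) * t).
    by rewrite /v; clearbody S M N; field; rewrite !gt_eqF//; lra.
  by rewrite mulNr -mulrN -mulf_div divff ?mul1r// gt_eqF//; lra.
exact.
Qed.
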